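(* Let $L,K$ be strictly concave kernel functions such that either $K$ satisfies condition $(\infty')$, or both $K$ and $L$ belong to $\mathrm{C}^1(0,2\pi)$. For $\mathbf{y}=(y_1,\dots,y_n)\in\mathbb{T}^n$ set $F(\mathbf{y},t)=L(t)+\sum_{j=1}^nK(t-y_j)$. Then there is a $\mathbf{w}^*=(w_1,\dots,w_n)\in\mathbb{T}^n$, unique up to permutation of its coordinates, with \[M:=\inf_{\mathbf{y}\in\mathbb{T}^n}\sup_{t\in\mathbb{T}}F(\mathbf{y},t)=\sup_{t\in\mathbb{T}}F(\mathbf{w}^*,t).\] Moreover: (a) the nodes $w_0=0,w_1,\dots,w_n$ are pairwise different and $\mathbf{w}^*$ is an equioscillation point, $m_0(\mathbf{w}^* )=\dots=m_n(\mathbf{w}^* )$; (b) $M=\inf_{\mathbf{y}\in\mathbb{T}^n}\max_{j=0,\dots,n}\sup_{t\in I_j(\mathbf{y})}F(\mathbf{y},t)=\sup_{\mathbf{y}\in\mathbb{T}^n}\min_{j=0,\dots,n}\sup_{t\in I_j(\mathbf{y})}F(\mathbf{y},t)=m$; (c) the Sandwich Property holds on $\mathbb{T}^n$: for all $\mathbf{x},\mathbf{y}\in\mathbb{T}^n$, $\underline{m}(\mathbf{x})\le m=M\le\overline{m}(\mathbf{y})$; (d) if moreover $L=K$, then the points $w_0=0,w_1,\dots,w_n$ are, after a permutation, equidistantly spaced in $\mathbb{T}$.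
   Context: Identify the torus $\mathbb{T}=\mathbb{R}/2\pi\mathbb{Z}$ with $[0,2\pi)$. A concave kernel function is a $2\pi$-periodic function $K:\mathbb{R}\to[-\infty,\infty)$ which is real-valued and concave on $(0,2\pi)$ and such that $\lim_{t\downarrow0}K(t)$ and $\lim_{t\uparrow2\pi}K(t)$ exist in $[-\infty,\infty)$ and are equal; it is strictly concave if strictly concave on $(0,2\pi)$. $D_\pm$ denote one-sided derivatives. Condition $(\infty')$ for $K$: either $\lim_{t\uparrow2\pi}D_-K(t)=\lim_{t\uparrow2\pi}D_+K(t)=-\infty$, or $\lim_{t\downarrow0}D_-K(t)=\lim_{t\downarrow0}D_+K(t)=+\infty$. For $\mathbf{y}\in\mathbb{T}^n$ put $y_0=0$, $y_{n+1}=2\pi$. For a permutation $\sigma$ of $\{1,\dots,n\}$ (with $\sigma(0)=0,\sigma(n+1)=n+1$) the closed simplex $\overline{S_\sigma}$ is the set of $\mathbf{y}$ with $0\le y_{\sigma(1)}\le\dots\le y_{\sigma(n)}\le2\pi$; for such $\mathbf{y}$ and $k=0,\dots,n$, $I_{\sigma(k)}(\mathbf{y})=[y_{\sigma(k)},y_{\sigma(k+1)}]$ and $m_{\sigma(k)}(\mathbf{y})=\sup_{t\in I_{\sigma(k)}(\mathbf{y})}F(\mathbf{y},t)$. For each $\mathbf{y}$ some $\sigma$ with $\mathbf{y}\in\overline{S_\sigma}$ is chosen; the quantities $\overline{m}(\mathbf{y})=\max_jm_j(\mathbf{y})=\sup_{t\in\mathbb{T}}F(\mathbf{y},t)$ and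 $\underline{m}(\mathbf{y})=\min_jm_j(\mathbf{y})$ do not depend on this choice. $m:=\sup_{\mathbf{y}\in\mathbb{T}^n}\underline{m}(\mathbf{y})$. An equioscillation point is a $\mathbf{y}$ with $m_0(\mathbf{y})=\dots=m_n(\mathbf{y})$.
   Formalization: The value of each kernel function at 0 (and at multiples of 2π) is required to equal its common one-sided limit there; with an arbitrary value at 0, e.g. one above the limit, part (a) can fail. *)

(* Defs.v *)
From Stdlib Require Import Reals Lra ClassicalEpsilon.
From Coquelicot Require Import Coquelicot.
Open Scope R_scope.

(* real part of a kernel (meaningful on (0,2pi), where kernels are real-valued) *)
Definition Kr (K : R -> Rbar) (t : R) : R := real (K t).

Definition in_open (t : R) : Prop := 0 < t < 2 * PI.

Definition is_lderiv (f : R -> R) (t d : R) : Prop :=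
  filterlim (fun h => (f (t + h) - f t) / h) (at_left 0) (locally d).
Definition is_rderiv (f : R -> R) (t d : R) : Prop :=
  filterlim (fun h => (f (t + h) - f t) / h) (at_right 0) (locally d).

(* Concave kernel function: 2pi-periodic, values in [-oo,+oo), real-valued and
   concave on (0,2pi), one-sided limits at 0+ and 2pi- exist in [-oo,+oo),
   are equal, and (convention of the paper) K(0) is this common limit. *)
Definition concave_kernel (K : R -> Rbar) : Prop :=
  (forall t, K (t + 2 * PI) = K t) /\
  (forall t, K t <> p_infty) /\
  (forall t, in_open t -> is_finite (K t)) /\
  (forall x y l, in_open x -> in_open y -> 0 <= l <= 1 ->
     l * Kr K x + (1 - l) * Kr K y <= Kr K (l * x + (1 - l) * y)) /\
  exists lim0 : Rbar, lim0 <> p_infty /\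
     filterlim (Kr K) (at_right 0) (Rbar_locally lim0) /\
     filterlim (Kr K) (at_left (2 * PI)) (Rbar_locally lim0) /\
     K 0 = lim0.

Definition strictly_concave_kernel (K : R -> Rbar) : Prop :=
  concave_kernel K /\
  (forall x y l, in_open x -> in_open y -> x <> y -> 0 < l < 1 ->
     l * Kr K x + (1 - l) * Kr K y < Kr K (l * x + (1 - l) * y)).

Definition cond_infty' (K : R -> Rbar) : Prop :=
  (exists dm dp : R -> R,
     (forall t, in_open t -> is_lderiv (Kr K) t (dm t) /\ is_rderiv (Kr K) t (dp t)) /\
     filterlim dm (at_left (2 * PI)) (Rbar_locally m_infty) /\
     filterlim dp (at_left (2 * PI)) (Rbar_locally m_infty))
  \/
  (exists dm dp : R -> R,
     (forall t, in_open t -> is_lderiv (Kr K) t (dm t) /\ is_rderiv (Kr K) t (dp t)) /\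
     filterlim dm (at_right 0) (Rbar_locally p_infty) /\
     filterlim dp (at_right 0) (Rbar_locally p_infty)).

Definition C1_open (K : R -> Rbar) : Prop :=
  exists dK : R -> R, forall t, in_open t ->
    is_derive (Kr K) t (dK t) /\ continuous dK t.

(* Points of T^n: y : nat -> R, coordinates y 1, ..., y n in [0,2pi). *)
Definition inT (n : nat) (y : nat -> R) : Prop :=
  forall j, (1 <= j <= n)%nat -> 0 <= y j < 2 * PI.

Definition ext (n : nat) (y : nat -> R) (j : nat) : R :=
  if Nat.eqb j 0 then 0 else if Nat.eqb j (S n) then 2 * PI else y j.

Fixpoint sumK (K : R -> Rbar) (y : nat -> R) (t : R) (n : nat) : Rbar :=
  match n with
  | O => Finite 0
  | S k => Rbar_plus (sumK K y t k) (K (t - y (S k)))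
  end.

Definition F (L K : R -> Rbar) (n : nat) (y : nat -> R) (t : R) : Rbar :=
  Rbar_plus (L t) (sumK K y t n).

Definition supB {A : Type} (P : A -> Prop) (f : A -> Rbar) : Rbar :=
  Rbar_lub (fun v => exists x, P x /\ v = f x).
Definition infB {A : Type} (P : A -> Prop) (f : A -> Rbar) : Rbar :=
  Rbar_glb (fun v => exists x, P x /\ v = f x).

Definition maxk (n : nat) (f : nat -> Rbar) : Rbar := supB (fun k => (k <= n)%nat) f.
Definition mink (n : nat) (f : nat -> Rbar) : Rbar := infB (fun k => (k <= n)%nat) f.

Definition perm_on (n : nat) (s : nat -> nat) : Prop :=
  (forall j, (1 <= j <= n)%nat -> (1 <= s j <= n)%nat) /\
  (forall i j, (1 <= i <= n)%nat -> (1 <= j <= n)%nat -> s i = s j -> i = j).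

Definition sext (n : nat) (s : nat -> nat) (k : nat) : nat :=
  if Nat.eqb k 0 then 0%nat else if Nat.eqb k (S n) then S n else s k.

Definition is_sorting (n : nat) (y : nat -> R) (s : nat -> nat) : Prop :=
  perm_on n s /\
  forall k, (k <= n)%nat -> ext n y (sext n s k) <= ext n y (sext n s (S k)).

Definition sort_perm (n : nat) (y : nat -> R) : nat -> nat :=
  epsilon (inhabits (fun k => k)) (fun s => is_sorting n y s).

(* m_{sigma(k)}(y) = sup over I_{sigma(k)}(y) = [y_{sigma(k)}, y_{sigma(k+1)}] of F(y,.) *)
Definition msig (L K : R -> Rbar) (n : nat) (y : nat -> R) (s : nat -> nat) (k : nat) : Rbar :=
  supB (fun t => ext n y (sext n s k) <= t <= ext n y (sext n s (S k))) (F L K n y).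

Definition mbar_intervals L K n y : Rbar := maxk n (msig L K n y (sort_perm n y)).
Definition munder L K n y : Rbar := mink n (msig L K n y (sort_perm n y)).

Definition supF L K n y : Rbar := supB (fun t => 0 <= t < 2 * PI) (F L K n y).

Definition bigM L K n : Rbar := infB (inT n) (supF L K n).
Definition smallm L K n : Rbar := supB (inT n) (munder L K n).

(* Main.v *)
Require Import Defs.
From Stdlib Require Import Reals Lra Lia List Permutation Sorting FinFun.
From Stdlib Require Import ClassicalEpsilon IndefiniteDescription.
From Coquelicot Require Import Coquelicot.
Open Scope R_scope.

(** For a sorted node vector [y] and [t] on its [j]-th arc, [F y t] is a sum of concave functions of
    [t] and of the differences [t - y_i].  A minimiser [w] of [sup F], with value [M], exists by
    compactness.  Because of the downward kinks of [K], its maximum points are not nodes; so by the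
    sum rule for supergradients every arc [j] that contains one (an active arc) carries a linear
    functional [k_j] such that [k_j . (y - w) < 0] for all [y <> w] with [m_j y >= M].

    If there were [d <> 0] with [k_j . d >= 0] for all active arcs, then [sup F] would be smaller
    than [M] along the ray from [w] in the direction [d].  As [n] functionals of the [n] free nodes
    always admit such a [d], all [n + 1] arcs are active: [w] equioscillates.  If some [x <> w] had
    [m_j x >= M] for all [j], then [d = w - x] would be such a direction; this gives both [m <= M]
    and uniqueness.  For [L = K], rotating the configuration by its first node gives another
    minimiser, and uniqueness forces equal spacing.

    The topological arguments use [exp F], which is real-valued and continuous even where
    [F = -oo]. *)

(** * Finite sums and homogeneous linear systems *)

Lemma sum_ge_term (f : nat -> R) (n k : nat) :
  (forall i, (i <= n)%nat -> 0 <= f i) -> (k <= n)%nat -> f k <= sum_f_R0 f n.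
Proof.
  intros Hf Hk. induction n as [|n IH]; simpl.
  - replace k with 0%nat by lia. lra.
  - assert (Hlast : 0 <= f (S n)) by (apply Hf; lia).
    destruct (Nat.eq_dec k (S n)) as [->|Hne].
    + assert (Hsum : sum_f_R0 (fun _ => 0) n <= sum_f_R0 f n).
      { apply sum_Rle. intros i Hi. apply Hf. lia. }
      rewrite sum_cte in Hsum. lra.
    + assert (f k <= sum_f_R0 f n) by (apply IH; [intros; apply Hf|]; lia). lra.
Qed.

Lemma sum_Rlt (f g : nat -> R) (n k : nat) :
  (forall i, (i <= n)%nat -> f i <= g i) -> (k <= n)%nat -> f k < g k ->
  sum_f_R0 f n < sum_f_R0 g n.
Proof.
  intros Hle Hk Hlt.
  assert (H : g k - f k <= sum_f_R0 (fun i => g i - f i) n).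
  { apply (sum_ge_term (fun i => g i - f i)); [|easy]. intros i Hi. specialize (Hle i Hi). lra. }
  rewrite minus_sum in H. lra.
Qed.

Definition extend {A : Type} (n : nat) (u : nat -> A) (a : A) (i : nat) : A :=
  if (i <=? n)%nat then u i else a.

Lemma extend_le {A : Type} n (u : nat -> A) a i : (i <= n)%nat -> extend n u a i = u i.
Proof. intros Hi. unfold extend. now rewrite (proj2 (Nat.leb_le i n) Hi). Qed.

Lemma extend_succ {A : Type} n (u : nat -> A) a : extend n u a (S n) = a.
Proof. unfold extend. now rewrite (proj2 (Nat.leb_gt (S n) n)) by lia. Qed.

Lemma sum_mult_extend (f d : nat -> R) (a : R) (n : nat) :
  sum_f_R0 (fun i => f i * extend n d a i) (S n) = sum_f_R0 (fun i => f i * d i) n + f (S n) * a.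
Proof.
  simpl. rewrite extend_succ. f_equal.
  apply sum_eq. intros i Hi. now rewrite extend_le.
Qed.

Lemma homogeneous_system_solution (n : nat) : forall l : list (nat -> R),
  (length l <= n)%nat ->
  exists d, (exists i, (i <= n)%nat /\ d i <> 0) /\
    forall f, In f l -> sum_f_R0 (fun i => f i * d i) n = 0.
Proof.
  induction n as [|n IH]; intros l Hl.
  - exists (fun _ => 1). split; [exists 0%nat; split; [lia|lra]|].
    destruct l; [now intros f|simpl in Hl; lia].
  - destruct (classic (exists p, In p l /\ p (S n) <> 0)) as [(p & Hp & Hp0)|Hno].
    + destruct (in_split p l Hp) as (l1 & l2 & ->).
      pose (eliminate := fun (f : nat -> R) i => f i - p i * (f (S n) / p (S n))).
      destruct (IH (map eliminate (l1 ++ l2))) as (d & (i & Hi & Hd) & Hz).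
      { rewrite length_map. rewrite length_app in *. simpl in Hl. lia. }
      exists (extend n d (- sum_f_R0 (fun i => p i * d i) n / p (S n))).
      split; [exists i; now rewrite extend_le; [split; [lia|]|]|].
      intros f Hf. rewrite sum_mult_extend.
      destruct (in_elt_inv _ _ _ _ Hf) as [<-|Hf']; [now field|].
      specialize (Hz _ (in_map eliminate _ _ Hf')). unfold eliminate in Hz.
      rewrite (sum_eq _ (fun i => f i * d i - p i * d i * (f (S n) / p (S n)))) in Hz
        by (intros; ring).
      rewrite minus_sum, <- scal_sum in Hz.
      replace (sum_f_R0 (fun i => f i * d i) n) with
        (f (S n) / p (S n) * sum_f_R0 (fun i => p i * d i) n) by lra.
      now field.
    + exists (extend n (fun _ => 0) 1).
      split; [exists (S n); rewrite extend_succ; split; [lia|lra]|].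
      intros f Hf. rewrite sum_mult_extend.
      assert (Hf0 : f (S n) = 0) by (apply NNPP; intros H; apply Hno; now exists f).
      rewrite Hf0, (sum_eq _ (fun _ => 0)) by (intros; ring). rewrite sum_cte. ring.
Qed.

(* The first coordinate, which belongs to the fixed node, uses up one of the [n + 1] unknowns;
   a single functional can be left out of the system and made nonnegative by changing signs. *)
Lemma common_nonneg_direction (n : nat) (l : list (nat -> R)) :
  (1 <= n)%nat -> (length l <= n)%nat ->
  exists d, d 0%nat = 0 /\ (exists i, (i <= n)%nat /\ d i <> 0) /\
    forall f, In f l -> 0 <= sum_f_R0 (fun i => f i * d i) n.
Proof.
  intros Hn Hl.
  pose (first := fun i => match i with O => 1 | S _ => 0 end).
  assert (Hfirst : forall d m, sum_f_R0 (fun i => first i * d i) m = d 0%nat).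
  { intros d m. induction m as [|m IH]; simpl; [|rewrite IH]; ring. }
  destruct (homogeneous_system_solution n (first :: tl l)) as (d & (i & Hi & Hd) & Hz).
  { destruct l; simpl in *; lia. }
  assert (Hd0 : d 0%nat = 0) by (rewrite <- (Hfirst d n); apply Hz; now left).
  destruct l as [|a l]; [now exists d; repeat split; [|exists i|]|].
  assert (Hl0 : forall f, In f l -> sum_f_R0 (fun i => f i * d i) n = 0).
  { intros f Hf. apply Hz. now right. }
  destruct (Rle_or_lt 0 (sum_f_R0 (fun i => a i * d i) n)) as [Ha|Ha].
  - exists d. repeat split; [easy|now exists i|].
    intros f [<-|Hf]; [easy|]. rewrite Hl0; [lra|easy].
  - exists (fun i => -1 * d i). repeat split; [lra|exists i; split; [easy|lra]|].
    assert (Hopp : forall f, sum_f_R0 (fun i => f i * (-1 * d i)) n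
                           = -1 * sum_f_R0 (fun i => f i * d i) n).
    { intros f. rewrite scal_sum. apply sum_eq. intros; ring. }
    intros f [<-|Hf]; rewrite Hopp; [lra|]. rewrite Hl0; [lra|easy].
Qed.

(** * Concave functions of one variable *)

Definition concave_on (D : R -> Prop) (f : R -> R) : Prop :=
  forall x y l, D x -> D y -> 0 <= l <= 1 ->
    D (l * x + (1 - l) * y) /\ l * f x + (1 - l) * f y <= f (l * x + (1 - l) * y).

Definition strictly_concave_on (D : R -> Prop) (f : R -> R) : Prop :=
  concave_on D f /\
  forall x y l, D x -> D y -> x <> y -> 0 < l < 1 ->
    l * f x + (1 - l) * f y < f (l * x + (1 - l) * y).

Definition slope (f : R -> R) (z u : R) : R := (f u - f z) / (u - z).

Definition supergradient (D : R -> Prop) (f : R -> R) (z k : R) : Prop :=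
  forall u, D u -> f u <= f z + k * (u - z).

Lemma concave_on_shift (D : R -> Prop) (f : R -> R) (c : R) :
  concave_on D f -> concave_on (fun t => D (t + c)) (fun t => f (t + c)).
Proof.
  intros Hf x y l Hx Hy Hl.
  replace (l * x + (1 - l) * y + c) with (l * (x + c) + (1 - l) * (y + c)) by ring.
  now apply Hf.
Qed.

Lemma strictly_concave_on_shift (D : R -> Prop) (f : R -> R) (c : R) :
  strictly_concave_on D f -> strictly_concave_on (fun t => D (t + c)) (fun t => f (t + c)).
Proof.
  intros [Hf Hs]. split; [now apply concave_on_shift|].
  intros x y l Hx Hy Hne Hl.
  replace (l * x + (1 - l) * y + c) with (l * (x + c) + (1 - l) * (y + c)) by ring.
  apply Hs; auto; lra.
Qed.

Lemma concave_on_sum (D : nat -> R -> Prop) (g : nat -> R -> R) (n : nat) :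
  (forall i, (i <= n)%nat -> concave_on (D i) (g i)) ->
  concave_on (fun t => forall i, (i <= n)%nat -> D i t) (fun t => sum_f_R0 (fun i => g i t) n).
Proof.
  intros Hg x y l Hx Hy Hl. split.
  - intros i Hi. apply (Hg i Hi x y l); auto.
  - rewrite !scal_sum, <- plus_sum. apply sum_Rle. intros i Hi.
    destruct (Hg i Hi x y l (Hx i Hi) (Hy i Hi) Hl). lra.
Qed.

Lemma concave_three_points (D : R -> Prop) (f : R -> R) (a b c : R) :
  concave_on D f -> D a -> D c -> a <= b <= c ->
  D b /\ (c - b) * f a + (b - a) * f c <= (c - a) * f b.
Proof.
  intros Hf Ha Hc Hb. destruct (Rle_lt_or_eq_dec a c) as [Hac|<-]; [lra| |].
  - pose (l := (c - b) / (c - a)).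
    assert (Hl : (c - a) * l = c - b) by (unfold l; field; lra).
    assert (Hl01 : 0 <= l <= 1).
    { split; [apply Rdiv_le_0_compat|apply Rle_div_l]; lra. }
    destruct (Hf a c l Ha Hc Hl01) as [Hdom Hle].
    replace (l * a + (1 - l) * c) with b in * by lra.
    split; [easy|].
    replace ((c - b) * f a + (b - a) * f c) with ((c - a) * (l * f a + (1 - l) * f c))
      by (replace (b - a) with ((c - a) - (c - b)) by ring; rewrite <- Hl; ring).
    apply Rmult_le_compat_l; lra.
  - replace b with a by lra. split; [easy|lra].
Qed.

Lemma concave_slope_decreasing (D : R -> Prop) (f : R -> R) (z u v : R) :
  concave_on D f -> D z -> D u -> D v -> u <= v -> u <> z -> v <> z ->
  slope f z v <= slope f z u.
Proof.
  intros Hf Hz Hu Hv Huv Huz Hvz.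
  pose (N := (v - z) * (f u - f z) - (u - z) * (f v - f z)).
  assert (Hdiff : slope f z u - slope f z v = N / ((u - z) * (v - z))).
  { unfold slope, N. field. lra. }
  enough (0 <= N / ((u - z) * (v - z))) by lra.
  assert (Huz' : u < z \/ z < u) by now apply Rdichotomy.
  assert (Hvz' : v < z \/ z < v) by now apply Rdichotomy.
  destruct (Rlt_or_le z u) as [Hzu|Hzu]; [|destruct (Rlt_or_le z v) as [Hzv|Hzv]].
  - destruct (concave_three_points D f z u v) as [_ H]; auto; [lra|].
    apply Rdiv_le_0_compat; [unfold N; lra|apply Rmult_lt_0_compat; lra].
  - destruct (concave_three_points D f u z v) as [_ H]; auto; [lra|].
    replace (N / ((u - z) * (v - z))) with (- N / ((z - u) * (v - z))) by (field; lra).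
    apply Rdiv_le_0_compat; [unfold N; lra|apply Rmult_lt_0_compat; lra].
  - destruct (concave_three_points D f u v z) as [_ H]; auto.
    replace (N / ((u - z) * (v - z))) with (N / ((z - u) * (z - v))) by (field; lra).
    apply Rdiv_le_0_compat; [unfold N; lra|apply Rmult_lt_0_compat; lra].
Qed.

Lemma supergradient_iff_slopes (D : R -> Prop) (f : R -> R) (z k : R) :
  supergradient D f z k <->
  forall u, D u -> (z < u -> slope f z u <= k) /\ (u < z -> k <= slope f z u).
Proof.
  unfold slope. split.
  - intros Hk u Hu. specialize (Hk u Hu). split; intros Huz.
    + apply Rle_div_l; lra.
    + replace ((f u - f z) / (u - z)) with ((f z - f u) / (z - u)) by (field; lra).
      apply Rle_div_r; lra.
  - intros Hk u Hu. destruct (Hk u Hu) as [Hright Hleft].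
    destruct (Rtotal_order u z) as [Huz|[->|Huz]]; [|lra|].
    + specialize (Hleft Huz).
      replace ((f u - f z) / (u - z)) with ((f z - f u) / (z - u)) in Hleft by (field; lra).
      apply Rle_div_r in Hleft; lra.
    + specialize (Hright Huz). apply Rle_div_l in Hright; lra.
Qed.

Lemma supergradient_strict (D : R -> Prop) (f : R -> R) (z k u : R) :
  strictly_concave_on D f -> D z -> supergradient D f z k -> D u -> u <> z ->
  f u < f z + k * (u - z).
Proof.
  intros [Hf Hs] Hz Hk Hu Hne.
  destruct (Hf u z (/ 2) Hu Hz) as [Hmid _]; [lra|].
  specialize (Hs u z (/ 2) Hu Hz Hne ltac:(lra)). specialize (Hk _ Hmid). lra.
Qed.

Section SupergradientOfSum.

Variables (Df Dg : R -> Prop) (f g : R -> R) (z c : R).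
Hypotheses (Hf : concave_on Df f) (Hg : concave_on Dg g) (Hfz : Df z) (Hgz : Dg z).
Hypothesis Hc : supergradient (fun t => Df t /\ Dg t) (fun t => f t + g t) z c.

Lemma slope_add_common (v : R) :
  v <> z -> slope (fun t => f t + g t) z v = slope f z v + slope g z v.
Proof. intros Hv. unfold slope. field. lra. Qed.

Lemma slope_add_right (t u : R) :
  Df t -> Dg u -> z < t -> z < u -> slope f z t + slope g z u <= c.
Proof.
  intros Ht Hu Hzt Hzu. pose (v := Rmin t u).
  assert (Hv : z < v <= t /\ v <= u).
  { unfold v. pose proof (Rmin_l t u). pose proof (Rmin_r t u).
    assert (z < Rmin t u) by now apply Rmin_glb_lt. lra. }
  destruct (concave_three_points Df f z v t Hf Hfz Ht) as [Hfv _]; [lra|].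
  destruct (concave_three_points Dg g z v u Hg Hgz Hu) as [Hgv _]; [lra|].
  apply Rle_trans with (slope f z v + slope g z v).
  - apply Rplus_le_compat;
      [apply (concave_slope_decreasing Df)|apply (concave_slope_decreasing Dg)]; auto; lra.
  - rewrite <- slope_add_common by lra.
    apply (proj1 (supergradient_iff_slopes _ _ _ _) Hc); [now split|easy].
Qed.

Lemma slope_add_left (t u : R) :
  Df t -> Dg u -> t < z -> u < z -> c <= slope f z t + slope g z u.
Proof.
  intros Ht Hu Hzt Hzu. pose (v := Rmax t u).
  assert (Hv : t <= v < z /\ u <= v).
  { unfold v. pose proof (Rmax_l t u). pose proof (Rmax_r t u).
    assert (Rmax t u < z) by now apply Rmax_lub_lt. lra. }
  destruct (concave_three_points Df f t v z Hf Ht Hfz) as [Hfv _]; [lra|].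
  destruct (concave_three_points Dg g u v z Hg Hu Hgz) as [Hgv _]; [lra|].
  apply Rle_trans with (slope f z v + slope g z v).
  - rewrite <- slope_add_common by lra.
    apply (proj1 (supergradient_iff_slopes _ _ _ _) Hc); [now split|easy].
  - apply Rplus_le_compat;
      [apply (concave_slope_decreasing Df)|apply (concave_slope_decreasing Dg)]; auto; lra.
Qed.

(* The supergradients of [g] form an interval between its right and its left slopes, and so do the
   numbers [a] for which [c - a] is a supergradient of [f]; the supremum of all the lower bounds is
   common to both intervals. *)
Lemma supergradient_add_inv :
  locally z Dg -> exists a, supergradient Df f z (c - a) /\ supergradient Dg g z a.
Proof.
  intros [r Hr].
  assert (Hball : forall u, Rabs (u - z) < r -> Dg u) by (intros u Hu; now apply Hr).
  assert (Hr0 := cond_pos r).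
  pose (lower := fun s => (exists u, Dg u /\ z < u /\ s = slope g z u) \/
                          (exists t, Df t /\ t < z /\ s = c - slope f z t)).
  assert (Hupper_g : forall s u, lower s -> Dg u -> u < z -> s <= slope g z u).
  { intros s u [(v & Hv & Hzv & ->)|(t & Ht & Htz & ->)] Hu Huz.
    - apply (concave_slope_decreasing Dg); auto; lra.
    - assert (H := slope_add_left t u Ht Hu Htz Huz). lra. }
  assert (Hupper_f : forall s t, lower s -> Df t -> z < t -> s <= c - slope f z t).
  { intros s t [(u & Hu & Hzu & ->)|(v & Hv & Hvz & ->)] Ht Hzt.
    - assert (H := slope_add_right t u Ht Hu Hzt Hzu). lra.
    - enough (slope f z t <= slope f z v) by lra.
      apply (concave_slope_decreasing Df); auto; lra. }
  destruct (completeness lower) as [a [Hub Hlub]].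
  - exists (slope g z (z - r / 2)). intros s Hs. apply Hupper_g; [easy| |lra].
    apply Hball, Rabs_def1; lra.
  - exists (slope g z (z + r / 2)). left. exists (z + r / 2).
    split; [apply Hball, Rabs_def1; lra|]. split; [lra|easy].
  - exists a. split; apply supergradient_iff_slopes; intros u Hu; split; intros Huz.
    + enough (a <= c - slope f z u) by lra.
      apply Hlub. intros s Hs. now apply Hupper_f.
    + enough (c - slope f z u <= a) by lra.
      apply Hub. right. now exists u.
    + apply Hub. left. now exists u.
    + apply Hlub. intros s Hs. now apply Hupper_g.
Qed.

End SupergradientOfSum.

Lemma supergradient_sum_inv (D : nat -> R -> Prop) (g : nat -> R -> R) (z : R) (n : nat) :
  (forall i, (i <= n)%nat -> concave_on (D i) (g i)) ->
  D 0%nat z -> (forall i, (1 <= i <= n)%nat -> locally z (D i)) ->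
  forall c, supergradient (fun t => forall i, (i <= n)%nat -> D i t)
                          (fun t => sum_f_R0 (fun i => g i t) n) z c ->
  exists k, (forall i, (i <= n)%nat -> supergradient (D i) (g i) z (k i)) /\ sum_f_R0 k n = c.
Proof.
  induction n as [|n IH]; intros Hg Hz0 Hz c Hc.
  - exists (fun _ => c). split; [|easy]. intros i Hi. replace i with 0%nat by lia.
    intros u Hu. apply (Hc u). intros j Hj. now replace j with 0%nat by lia.
  - assert (Hzn : forall i, (i <= S n)%nat -> D i z).
    { intros [|i] Hi; [easy|]. apply locally_singleton, Hz. lia. }
    destruct (supergradient_add_inv (fun t => forall i, (i <= n)%nat -> D i t) (D (S n))
      (fun t => sum_f_R0 (fun i => g i t) n) (g (S n)) z c) as (a & Hsum & Hlast); auto.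
    + apply concave_on_sum. intros i Hi. apply Hg. lia.
    + intros t [Ht HSt]. apply (Hc t). intros i Hi.
      destruct (Nat.eq_dec i (S n)) as [->|]; [easy|apply Ht; lia].
    + apply Hz. lia.
    + destruct (IH ltac:(intros; apply Hg; lia) Hz0 ltac:(intros; apply Hz; lia) (c - a) Hsum)
        as (k & Hk & Hkc).
      exists (extend n k a). split.
      * intros i Hi. destruct (Nat.eq_dec i (S n)) as [->|]; [now rewrite extend_succ|].
        rewrite extend_le by lia. apply Hk. lia.
      * simpl. rewrite extend_succ, (sum_eq _ k) by (intros; now apply extend_le). lra.
Qed.

(** * Lower slopes and one-sided derivatives *)

Lemma filter_forall_upto {T : Type} {Fl : (T -> Prop) -> Prop} {FF : Filter Fl}
  (P : nat -> T -> Prop) (n : nat) :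
  (forall i, (i <= n)%nat -> Fl (P i)) -> Fl (fun x => forall i, (i <= n)%nat -> P i x).
Proof.
  induction n as [|n IH]; intros HP.
  - apply (filter_imp (P 0%nat)); [|now apply HP].
    intros x Hx i Hi. now replace i with 0%nat by lia.
  - apply (filter_imp (fun x => (forall i, (i <= n)%nat -> P i x) /\ P (S n) x)).
    + intros x [Hx HSx] i Hi. destruct (Nat.eq_dec i (S n)) as [->|]; [easy|apply Hx; lia].
    + apply filter_and; [apply IH; intros|]; apply HP; lia.
Qed.

Lemma locally_at_right (P : R -> Prop) (a b : R) :
  a < b -> (forall x, a < x < b -> P x) -> at_right a P.
Proof.
  intros Hab HP. unfold at_right, within.
  apply (filter_imp (fun x => x < b)); [|now apply open_lt].
  intros x Hxb Hax. apply HP. lra.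
Qed.

Lemma filterlim_shift_at_left (a b c : R) :
  a + c = b -> filterlim (fun t => t + c) (at_left a) (at_left b).
Proof.
  intros <- P HP.
  assert (Hcont : continuous (fun t => t + c) a)
    by (apply (ex_derive_continuous (fun t => t + c)); now auto_derive).
  generalize (Hcont (fun t => t < a + c -> P t) HP). unfold filtermap, at_left, within.
  apply filter_imp.
  intros t Ht Hta. apply Ht. lra.
Qed.

Lemma locally_comp_shift (D : R -> Prop) (t c : R) :
  locally (t + c) D -> locally t (fun u => D (u + c)).
Proof.
  intros HD. apply (ex_derive_continuous (fun u => u + c) t); [now auto_derive|easy].
Qed.

Lemma locally_comp_at_right (D : R -> Prop) (t e : R) :
  locally t D -> at_right 0 (fun h => D (t + h * e)).
Proof.
  intros HD. apply (filter_le_within (F := locally 0)).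
  assert (Hcont : continuous (fun h => t + h * e) 0)
    by (apply (ex_derive_continuous (fun h => t + h * e)); now auto_derive).
  apply Hcont. now rewrite Rmult_0_l, Rplus_0_r.
Qed.

Definition lower_slope (f : R -> R) (u e b : R) : Prop :=
  at_right 0 (fun h => b * h <= f (u + h * e) - f u).

Lemma lower_slope_ext (f g : R -> R) (u v e b : R) :
  (forall h, f (u + h) = g (v + h)) -> lower_slope f u e b -> lower_slope g v e b.
Proof.
  intros Hfg. assert (Hfg0 := Hfg 0). rewrite !Rplus_0_r in Hfg0.
  unfold lower_slope. apply filter_imp. intros h Hh. now rewrite <- Hfg, <- Hfg0.
Qed.

Lemma lower_slope_sum (g : nat -> R -> R) (b : nat -> R) (u e : R) (n : nat) :
  (forall i, (i <= n)%nat -> lower_slope (g i) u e (b i)) ->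
  lower_slope (fun t => sum_f_R0 (fun i => g i t) n) u e (sum_f_R0 b n).
Proof.
  intros Hg. unfold lower_slope. generalize (filter_forall_upto _ n Hg).
  apply filter_imp. intros h Hh.
  rewrite Rmult_comm, scal_sum, <- minus_sum. now apply sum_Rle.
Qed.

Lemma lower_slope_pos_increases (f : R -> R) (u e b : R) (P : R -> Prop) :
  lower_slope f u e b -> 0 < b -> locally u P -> exists t, P t /\ f u < f t.
Proof.
  intros Hf Hb HP.
  assert (Hpos : at_right 0 (fun h => 0 < h)) by (apply (locally_at_right _ 0 1); intros; lra).
  destruct (filter_ex _ (filter_and _ _ Hpos
    (filter_and _ _ Hf (locally_comp_at_right P u e HP)))) as (h & Hh & Hle & HPh).
  exists (u + h * e). split; [easy|].
  assert (0 < b * h) by now apply Rmult_lt_0_compat. lra.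
Qed.

Lemma concave_lower_slope (D : R -> Prop) (f : R -> R) (z e r : R) :
  concave_on D f -> D z -> 0 < r -> D (z + r * e) ->
  lower_slope f z e ((f (z + r * e) - f z) / r).
Proof.
  intros Hf Hz Hr Hzr. apply (locally_at_right _ 0 r Hr). intros h Hh.
  assert (Hl : 0 <= h / r <= 1) by (split; [apply Rdiv_le_0_compat|apply Rle_div_l]; lra).
  destruct (Hf _ _ _ Hzr Hz Hl) as [_ Hle].
  replace (h / r * (z + r * e) + (1 - h / r) * z) with (z + h * e) in Hle by (field; lra).
  replace ((f (z + r * e) - f z) / r * h) with (h / r * f (z + r * e) + (1 - h / r) * f z - f z)
    by (field; lra). lra.
Qed.

Lemma is_derive_lower_slope (f : R -> R) (u d e eps : R) :
  is_derive f u d -> 0 < eps -> lower_slope f u e (e * d - eps).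
Proof.
  intros Hd Heps.
  assert (Hline : is_derive (fun h => f (u + h * e)) 0 (e * d)).
  { apply (is_derive_comp f (fun h => u + h * e)).
    - now rewrite Rmult_0_l, Rplus_0_r.
    - auto_derive; [easy|ring]. }
  apply is_derive_Reals in Hline. destruct (Hline eps Heps) as [delta Hdelta].
  apply (locally_at_right _ 0 delta (cond_pos delta)). intros h Hh.
  specialize (Hdelta h ltac:(lra)). rewrite Rabs_pos_eq in Hdelta by lra.
  specialize (Hdelta ltac:(lra)). rewrite Rmult_0_l, Rplus_0_l, Rplus_0_r in Hdelta.
  apply Rabs_def2 in Hdelta. apply Rlt_le, Rlt_div_r; lra.
Qed.

Lemma concave_rderiv_le_slope (D : R -> Prop) (f : R -> R) (a t d : R) :
  concave_on D f -> D a -> a < t -> locally t D -> is_rderiv f t d -> d <= slope f t a.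
Proof.
  intros Hf Ha Hat Ht Hd.
  apply (filterlim_le (F := at_right 0) (fun h => (f (t + h) - f t) / h) (fun _ => slope f t a)
    d (slope f t a)); [|easy|apply filterlim_const].
  generalize (locally_comp_at_right D t 1 Ht). unfold at_right, within.
  apply filter_imp. intros h HD Hh. specialize (HD Hh). rewrite Rmult_1_r in HD.
  replace ((f (t + h) - f t) / h) with (slope f t (t + h)) by (unfold slope; f_equal; ring).
  apply (concave_slope_decreasing D); auto; try lra. now apply locally_singleton.
Qed.

Lemma slope_le_concave_lderiv (D : R -> Prop) (f : R -> R) (t b d : R) :
  concave_on D f -> D b -> t < b -> locally t D -> is_lderiv f t d -> slope f t b <= d.
Proof.
  intros Hf Hb Htb Ht Hd.
  assert (Hopp : filterlim (fun h => slope f t (t - h)) (at_right 0) (locally d)).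
  { apply (filterlim_ext (fun h => (f (t + - h) - f t) / - h));
      [intros h; unfold slope, Rminus; f_equal; ring|].
    apply (filterlim_comp _ _ _ Ropp (fun h => (f (t + h) - f t) / h) _ (at_left 0)); [|easy].
    rewrite <- Ropp_0 at 2. apply filterlim_Ropp_right. }
  apply (filterlim_le (F := at_right 0) (fun _ => slope f t b) (fun h => slope f t (t - h))
    (slope f t b) d); [|apply filterlim_const|easy].
  generalize (locally_comp_at_right D t (-1) Ht). unfold at_right, within.
  apply filter_imp. intros h HD Hh. specialize (HD Hh).
  replace (t + h * -1) with (t - h) in HD by ring.
  apply (concave_slope_decreasing D); auto; try lra. now apply locally_singleton.
Qed.

Lemma concave_continuous (D : R -> Prop) (f : R -> R) (z : R) :
  concave_on D f -> locally z D -> continuous f z.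
Proof.
  intros Hf [r Hr]. assert (Hr0 := cond_pos r).
  assert (Hball : forall u, Rabs (u - z) < r -> D u) by (intros u Hu; now apply Hr).
  assert (Hz : D z) by (apply Hball; rewrite Rminus_diag, Rabs_R0; lra).
  assert (Hright : D (z + r / 2)) by (apply Hball, Rabs_def1; lra).
  assert (Hleft : D (z - r / 2)) by (apply Hball, Rabs_def1; lra).
  pose (B := Rabs (slope f z (z + r / 2)) + Rabs (slope f z (z - r / 2)) + 1).
  assert (HB : 0 < B).
  { unfold B. pose proof (Rabs_pos (slope f z (z + r / 2))).
    pose proof (Rabs_pos (slope f z (z - r / 2))). lra. }
  apply filterlim_locally. intros eps.
  assert (Hdelta : 0 < Rmin (r / 2) (eps / B))
    by (apply Rmin_glb_lt; [lra|apply Rdiv_lt_0_compat; [apply cond_pos|easy]]).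
  exists (mkposreal _ Hdelta). intros u Hu. change (Rabs (f u - f z) < eps).
  assert (Hu' : Rabs (u - z) < Rmin (r / 2) (eps / B)) by exact Hu.
  destruct (Rmin_Rgt_l _ _ _ Hu') as [Hur Hueps]. apply Rlt_div_r in Hueps; [|easy].
  destruct (Req_dec u z) as [->|Hne].
  { rewrite Rminus_diag, Rabs_R0. apply cond_pos. }
  assert (Du : D u) by (apply Hball; lra).
  apply Rabs_def2 in Hur.
  assert (Hlower : slope f z (z + r / 2) <= slope f z u)
    by (apply (concave_slope_decreasing D); auto; lra).
  assert (Hupper : slope f z u <= slope f z (z - r / 2))
    by (apply (concave_slope_decreasing D); auto; lra).
  replace (f u - f z) with (slope f z u * (u - z)) by (unfold slope; field; lra).
  rewrite Rabs_mult. apply Rle_lt_trans with (2 := Hueps). rewrite Rmult_comm.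
  apply Rmult_le_compat_l; [apply Rabs_pos|].
  pose proof (Rabs_maj2 (slope f z (z + r / 2))).
  pose proof (Rle_abs (slope f z (z - r / 2))).
  pose proof (Rabs_pos (slope f z (z + r / 2))).
  pose proof (Rabs_pos (slope f z (z - r / 2))).
  unfold B. apply Rabs_le. lra.
Qed.

(** * Periodic functions and concave kernels *)

Definition periodic {A : Type} (f : R -> A) : Prop := forall t, f (t + 2 * PI) = f t.

Lemma two_PI_pos : 0 < 2 * PI.
Proof. pose proof PI_RGT_0; lra. Qed.

Lemma periodic_IZR {A : Type} (f : R -> A) (k : Z) (t : R) :
  periodic f -> f (t + IZR k * (2 * PI)) = f t.
Proof.
  intros Hf. revert t. induction k as [|k IH|k IH] using Z.peano_ind; intros t.
  - now rewrite Rmult_0_l, Rplus_0_r.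
  - rewrite succ_IZR, <- (IH t), <- (Hf (t + IZR k * (2 * PI))). f_equal; ring.
  - rewrite <- Hf, <- (IH t). f_equal. unfold Z.pred. rewrite plus_IZR. ring.
Qed.

Lemma period_shift_exists (r : R) : exists c, 0 <= r + c < 2 * PI /\
  forall (A : Type) (f : R -> A), periodic f -> forall t, f (t + c) = f t.
Proof.
  pose proof two_PI_pos as HP.
  destruct (euclidian_division r (2 * PI)) as (k & s & Hr & Hs); [lra|].
  rewrite Rabs_pos_eq in Hs by lra.
  exists (IZR (- k) * (2 * PI)). split; [rewrite opp_IZR; lra|].
  intros A f Hf t. now apply periodic_IZR.
Qed.

(* The value at [p_infty], which kernels do not take, is junk. *)
Definition exp_Rbar (x : Rbar) : R := match x with Finite r => exp r | _ => 0 end.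

Lemma exp_Rbar_ge0 (x : Rbar) : 0 <= exp_Rbar x.
Proof. destruct x; simpl; try lra. left; apply exp_pos. Qed.

Lemma exp_Rbar_finite (x : Rbar) : is_finite x -> exp_Rbar x = exp (real x).
Proof. now intros <-. Qed.

Lemma is_finite_exp_Rbar (x : Rbar) : is_finite x <-> 0 < exp_Rbar x.
Proof.
  split; [intros Hx; rewrite exp_Rbar_finite by easy; apply exp_pos|].
  destruct x; simpl; intros Hx; [easy|lra|lra].
Qed.

Lemma exp_Rbar_le (x y : Rbar) :
  x <> p_infty -> y <> p_infty -> Rbar_le x y <-> exp_Rbar x <= exp_Rbar y.
Proof.
  destruct x as [x| |], y as [y| |]; simpl; intros Hx Hy; try congruence; split; intros H;
    try easy; try lra.
  - destruct H as [H|H]; [left; now apply exp_increasing|right; now rewrite H].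
  - destruct H as [H|H]; [left; now apply exp_lt_inv|right; now apply exp_inv].
  - pose proof (exp_pos x); lra.
  - left; apply exp_pos.
Qed.

Lemma exp_Rbar_plus (x y : Rbar) :
  x <> p_infty -> y <> p_infty -> exp_Rbar (Rbar_plus x y) = exp_Rbar x * exp_Rbar y.
Proof.
  destruct x as [x| |], y as [y| |]; simpl; intros Hx Hy; try congruence; try ring.
  apply exp_plus.
Qed.

Lemma Rbar_plus_not_p_infty (x y : Rbar) :
  x <> p_infty -> y <> p_infty -> Rbar_plus x y <> p_infty.
Proof. destruct x, y; simpl; congruence. Qed.

Lemma filterlim_exp_Rbar {T : Type} (Fl : (T -> Prop) -> Prop) {FF : Filter Fl}
  (g : T -> R) (l : Rbar) :
  l <> p_infty -> filterlim g Fl (Rbar_locally l) ->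
  filterlim (fun t => exp (g t)) Fl (locally (exp_Rbar l)).
Proof.
  intros Hl Hg. destruct l as [l| |]; [|easy|].
  - apply (filterlim_comp _ _ _ g exp _ (locally l)); [easy|apply continuous_exp].
  - apply (filterlim_comp _ _ _ g exp _ (Rbar_locally m_infty)); [easy|apply is_lim_exp_m].
Qed.

Lemma continuous_of_sides (f : R -> R) (x : R) :
  filterlim f (at_left x) (locally (f x)) -> filterlim f (at_right x) (locally (f x)) ->
  continuous f x.
Proof.
  intros Hleft Hright P HP. specialize (Hleft P HP). specialize (Hright P HP).
  unfold filtermap, at_left, at_right, within in *.
  generalize (filter_and _ _ Hleft Hright). apply filter_imp. intros y [Hl Hr].
  destruct (Rtotal_order y x) as [H|[->|H]]; auto.
  now apply locally_singleton.
Qed.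

Lemma locally_in_open (t : R) : in_open t -> locally t in_open.
Proof.
  intros Ht. apply (open_and (fun u => 0 < u) (fun u => u < 2 * PI)); [| |exact Ht].
  - apply open_gt.
  - apply open_lt.
Qed.

Lemma in_open_between (x y l : R) :
  0 <= x <= 2 * PI -> 0 <= y <= 2 * PI -> x <> y -> 0 < l < 1 -> in_open (l * x + (1 - l) * y).
Proof.
  intros Hx Hy Hne Hl. unfold in_open.
  destruct (Rtotal_order x y) as [H|[H|H]]; [|easy|]; nra.
Qed.

Definition kernel_dom (Q : R -> Rbar) (t : R) : Prop := 0 <= t <= 2 * PI /\ is_finite (Q t).

Section ConcaveKernel.

Variable Q : R -> Rbar.
Hypothesis HQ : concave_kernel Q.

Lemma kernel_periodic : periodic Q.
Proof. exact (proj1 HQ). Qed.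

Lemma kernel_not_p_infty (t : R) : Q t <> p_infty.
Proof. exact (proj1 (proj2 HQ) t). Qed.

Lemma in_open_kernel_dom (t : R) : in_open t -> kernel_dom Q t.
Proof.
  intros Ht. destruct HQ as (_ & _ & Hfin & _).
  split; [unfold in_open in Ht; lra|now apply Hfin].
Qed.

Lemma locally_kernel_dom (t : R) : in_open t -> locally t (kernel_dom Q).
Proof.
  intros Ht. generalize (locally_in_open t Ht). apply filter_imp. apply in_open_kernel_dom.
Qed.

Lemma kernel_dom_0 : is_finite (Q 0) -> kernel_dom Q 0.
Proof. intros Hfin. pose proof two_PI_pos. split; [lra|easy]. Qed.

Lemma kernel_dom_2PI : is_finite (Q 0) -> kernel_dom Q (2 * PI).
Proof.
  intros Hfin. pose proof two_PI_pos. split; [lra|].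
  now rewrite <- (Rplus_0_l (2 * PI)), kernel_periodic.
Qed.

Lemma exp_kernel_open (t : R) : in_open t -> exp_Rbar (Q t) = exp (Kr Q t).
Proof. intros Ht. now apply exp_Rbar_finite, in_open_kernel_dom. Qed.

Lemma kernel_concave_on_open : concave_on in_open (Kr Q).
Proof.
  destruct HQ as (_ & _ & _ & Hconc & _).
  intros x y l Hx Hy Hl. split; [|now apply Hconc].
  destruct (Req_dec x y) as [->|Hne]; [now replace (l * y + (1 - l) * y) with y by ring|].
  destruct (Req_dec l 0) as [->|Hl0]; [now replace (0 * x + (1 - 0) * y) with y by ring|].
  destruct (Req_dec l 1) as [->|Hl1]; [now replace (1 * x + (1 - 1) * y) with x by ring|].
  unfold in_open in *. apply in_open_between; lra.
Qed.

Lemma exp_kernel_continuous_open (t : R) : in_open t -> continuous (fun u => exp_Rbar (Q u)) t.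
Proof.
  intros Ht. apply (continuous_ext_loc _ (fun u => exp (Kr Q u))).
  - generalize (locally_in_open t Ht). apply filter_imp. intros u Hu. now rewrite exp_kernel_open.
  - apply (continuous_comp (Kr Q) exp); [|apply continuous_exp].
    apply (concave_continuous in_open); [apply kernel_concave_on_open|now apply locally_in_open].
Qed.

Lemma exp_kernel_continuous_0 : continuous (fun u => exp_Rbar (Q u)) 0.
Proof.
  pose proof two_PI_pos as HP. destruct HQ as (_ & _ & _ & _ & l & Hl & Hright & Hleft & <-).
  apply continuous_of_sides.
  - apply (filterlim_ext_loc (fun t => exp (Kr Q (t + 2 * PI)))).
    + unfold at_left, within. apply (filter_imp (fun t => - (2 * PI) < t)); [|apply open_gt; lra].
      intros t Ht Ht0. rewrite <- exp_kernel_open, kernel_periodic by (unfold in_open; lra).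
      reflexivity.
    + apply filterlim_exp_Rbar; [typeclasses eauto|easy|].
      apply (filterlim_comp _ _ _ (fun t => t + 2 * PI) (Kr Q) _ (at_left (2 * PI)));
        [apply filterlim_shift_at_left; ring|easy].
  - apply (filterlim_ext_loc (fun t => exp (Kr Q t))).
    + apply (locally_at_right _ 0 (2 * PI) HP). intros t Ht. now rewrite exp_kernel_open.
    + apply filterlim_exp_Rbar; [typeclasses eauto|easy|easy].
Qed.

Lemma exp_kernel_continuous (t : R) : continuous (fun u => exp_Rbar (Q u)) t.
Proof.
  destruct (period_shift_exists t) as (c & Hc & Hper).
  apply (continuous_ext (fun u => exp_Rbar (Q (u + c)))).
  { intros u. now rewrite (Hper _ Q kernel_periodic). }
  apply (continuous_comp (fun u => u + c) (fun u => exp_Rbar (Q u))).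
  - apply (ex_derive_continuous (fun u => u + c)). now auto_derive.
  - destruct (Req_dec (t + c) 0) as [->|Hne]; [apply exp_kernel_continuous_0|].
    apply exp_kernel_continuous_open. unfold in_open. lra.
Qed.

Lemma kernel_continuous_finite (t : R) : is_finite (Q t) -> continuous (Kr Q) t.
Proof.
  intros Ht. apply is_finite_exp_Rbar in Ht.
  apply (continuous_ext_loc _ (fun u => ln (exp_Rbar (Q u)))).
  - generalize (exp_kernel_continuous t _ (open_gt 0 _ Ht)). unfold filtermap. apply filter_imp.
    intros u Hu. apply is_finite_exp_Rbar in Hu. rewrite exp_Rbar_finite by easy. apply ln_exp.
  - apply (continuous_comp (fun u => exp_Rbar (Q u)) ln);
      [apply exp_kernel_continuous|now apply continuous_ln].
Qed.

Lemma kernel_limit_towards_PI (u : R) :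
  is_finite (Q u) ->
  filterlim (fun e => Kr Q (u + e * (PI - u))) (at_right 0) (locally (Kr Q u)).
Proof.
  intros Hu. apply (filterlim_filter_le_1 _ (filter_le_within _)).
  apply (filterlim_comp _ _ _ (fun e => u + e * (PI - u)) (Kr Q) _ (locally u));
    [|now apply kernel_continuous_finite].
  replace (locally u) with (locally (u + 0 * (PI - u))) by (f_equal; ring).
  apply (ex_derive_continuous (fun e => u + e * (PI - u)) 0). now auto_derive.
Qed.

(* Concavity is inherited from the open interval by contracting towards its midpoint. *)
Lemma kernel_concave_on_dom : concave_on (kernel_dom Q) (Kr Q).
Proof.
  intros x y l Hx Hy Hl. pose proof PI_RGT_0 as HP.
  destruct (Req_dec x y) as [->|Hne].
  { replace (l * y + (1 - l) * y) with y by ring. split; [easy|lra]. }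
  destruct (Req_dec l 0) as [->|Hl0].
  { replace (0 * x + (1 - 0) * y) with y by ring. split; [easy|lra]. }
  destruct (Req_dec l 1) as [->|Hl1].
  { replace (1 * x + (1 - 1) * y) with x by ring. split; [easy|lra]. }
  set (m := l * x + (1 - l) * y).
  assert (Hm : kernel_dom Q m).
  { apply in_open_kernel_dom, in_open_between; [apply Hx|apply Hy|easy|lra]. }
  split; [easy|]. pose (contract := fun u e => u + e * (PI - u)).
  apply (filterlim_le (F := at_right 0)
    (fun e => l * Kr Q (contract x e) + (1 - l) * Kr Q (contract y e))
    (fun e => Kr Q (contract m e)) (l * Kr Q x + (1 - l) * Kr Q y) (Kr Q m)).
  - apply (locally_at_right _ 0 1 Rlt_0_1). intros e He.
    replace (contract m e) with (l * contract x e + (1 - l) * contract y e)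
      by (unfold contract, m; ring).
    assert (Hin : forall u, 0 <= u <= 2 * PI -> in_open (contract u e))
      by (intros u Hu; unfold in_open, contract; nra).
    apply kernel_concave_on_open; auto; apply Hin; [apply Hx|apply Hy].
  - assert (Hscal : forall a u, is_finite (Q u) ->
      filterlim (fun e => a * Kr Q (contract u e)) (at_right 0) (locally (a * Kr Q u))).
    { intros a u Hu. apply (filterlim_comp _ _ _ (fun e => Kr Q (contract u e)) (Rmult a) _
        (locally (Kr Q u))); [now apply kernel_limit_towards_PI|].
      apply (filterlim_scal_r (V := R_NormedModule) a). }
    apply (filterlim_comp_2 (G := locally (l * Kr Q x)) (H := locally ((1 - l) * Kr Q y)));
      [apply Hscal, Hx|apply Hscal, Hy|apply (filterlim_plus (V := R_NormedModule))].
  - apply kernel_limit_towards_PI, Hm.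
Qed.

End ConcaveKernel.

Lemma kernel_strictly_concave_on_dom (Q : R -> Rbar) :
  strictly_concave_kernel Q -> strictly_concave_on (kernel_dom Q) (Kr Q).
Proof.
  intros [HQ Hstrict]. split; [now apply kernel_concave_on_dom|].
  intros x y l Hx Hy Hne Hl. set (m := l * x + (1 - l) * y).
  assert (Hm : kernel_dom Q m).
  { apply in_open_kernel_dom, in_open_between; [easy|apply Hx|apply Hy|easy|easy]. }
  assert (Hmid : forall u, kernel_dom Q u -> u <> m ->
    in_open (/ 2 * u + (1 - / 2) * m) /\
    / 2 * Kr Q u + / 2 * Kr Q m <= Kr Q (/ 2 * u + (1 - / 2) * m)).
  { intros u Hu Hum. split; [apply in_open_between; [apply Hu|apply Hm|easy|lra]|].
    destruct (kernel_concave_on_dom Q HQ u m (/ 2) Hu Hm) as [_ H]; lra. }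
  destruct (Hmid x Hx) as [Hx' HKx]; [unfold m; nra|].
  destruct (Hmid y Hy) as [Hy' HKy]; [unfold m; nra|].
  assert (H := Hstrict _ _ l Hx' Hy' ltac:(lra) Hl).
  replace (l * (/ 2 * x + (1 - / 2) * m) + (1 - l) * (/ 2 * y + (1 - / 2) * m)) with m in H
    by (unfold m; field).
  nra.
Qed.

(** * Slopes of kernels *)

Definition direction (e : R) : Prop := e = 1 \/ e = -1.

Lemma kernel_lower_slope (Q : R -> Rbar) (u e : R) :
  concave_kernel Q -> is_finite (Q u) -> direction e -> exists b, lower_slope (Kr Q) u e b.
Proof.
  intros HQ Hu He.
  destruct (period_shift_exists u) as (c & Hc & Hper).
  assert (Hcase : exists z, 0 <= z <= 2 * PI /\ (forall t, Q (z + t) = Q (u + t)) /\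
                            exists r, 0 < r /\ in_open (z + r * e)).
  { assert (Hz : forall t, Q (u + c + t) = Q (u + t)).
    { intros t. rewrite <- (Hper _ Q (kernel_periodic Q HQ) (u + t)). f_equal; ring. }
    unfold in_open. destruct He as [-> | ->].
    - exists (u + c). repeat split; [lra|lra|apply Hz|].
      exists (PI - (u + c) / 2). lra.
    - destruct (Req_dec (u + c) 0) as [Huc|Huc].
      + exists (u + c + 2 * PI). repeat split; [lra|lra| |exists PI; lra].
        intros t. rewrite <- Hz, <- (kernel_periodic Q HQ (u + c + t)). f_equal; ring.
      + exists (u + c). repeat split; [lra|lra|apply Hz|]. exists ((u + c) / 2). lra. }
  destruct Hcase as (z & Hz & HQz & r & Hr & Hzr).
  exists ((Kr Q (z + r * e) - Kr Q z) / r).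
  apply (lower_slope_ext (Kr Q) _ z); [intros h; unfold Kr; now rewrite HQz|].
  apply (concave_lower_slope (kernel_dom Q)); [now apply kernel_concave_on_dom| |easy|].
  - split; [easy|]. now rewrite <- (Rplus_0_r z), HQz, Rplus_0_r.
  - now apply in_open_kernel_dom.
Qed.

(* By periodicity [Q] has the same value at both ends of the period, below its value at [PI]. *)
Lemma kernel_node_kink (Q : R -> Rbar) :
  strictly_concave_kernel Q -> is_finite (Q 0) ->
  exists s, 0 < s /\ forall e, direction e -> lower_slope (Kr Q) 0 e s.
Proof.
  intros SQ Hfin. pose proof SQ as [HQ _]. pose proof PI_RGT_0 as HP.
  destruct (kernel_strictly_concave_on_dom Q SQ) as [Hconc Hstrict].
  assert (D0 := kernel_dom_0 Q Hfin). assert (D2PI := kernel_dom_2PI Q HQ Hfin).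
  assert (DPI : kernel_dom Q PI) by (apply in_open_kernel_dom; [easy|unfold in_open; lra]).
  assert (Eper : forall t, Kr Q (2 * PI + t) = Kr Q t).
  { intros t. unfold Kr. now rewrite Rplus_comm, kernel_periodic. }
  assert (Eend := Eper 0). rewrite Rplus_0_r in Eend.
  exists ((Kr Q PI - Kr Q 0) / PI). split.
  - assert (H := Hstrict 0 (2 * PI) (/ 2) D0 D2PI ltac:(lra) ltac:(lra)).
    replace (/ 2 * 0 + (1 - / 2) * (2 * PI)) with PI in H by field.
    apply Rdiv_lt_0_compat; lra.
  - intros e [-> | ->].
    + replace PI with (0 + PI * 1) at 1 by ring.
      apply (concave_lower_slope (kernel_dom Q)); auto.
      now replace (0 + PI * 1) with PI by ring.
    + rewrite <- Eend. replace PI with (2 * PI + PI * -1) at 1 by ring.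
      apply (lower_slope_ext (Kr Q) _ (2 * PI)); [intros h; now rewrite Eper, Rplus_0_l|].
      apply (concave_lower_slope (kernel_dom Q)); auto.
      now replace (2 * PI + PI * -1) with PI by ring.
Qed.

Lemma C1_kernel_lower_slopes (Q : R -> Rbar) (u eps : R) :
  strictly_concave_kernel Q -> C1_open Q -> is_finite (Q u) -> 0 < eps ->
  exists b b', - eps <= b + b' /\ lower_slope (Kr Q) u 1 b /\ lower_slope (Kr Q) u (-1) b'.
Proof.
  intros SQ [dQ HdQ] Hu Heps. pose proof SQ as [HQ _].
  destruct (period_shift_exists u) as (c & Hc & Hper).
  specialize (Hper _ Q (kernel_periodic Q HQ)).
  assert (Hext : forall h, Kr Q (u + c + h) = Kr Q (u + h)).
  { intros h. unfold Kr. rewrite <- (Hper (u + h)). f_equal; f_equal; ring. }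
  enough (exists b b', - eps <= b + b' /\ lower_slope (Kr Q) (u + c) 1 b /\
                       lower_slope (Kr Q) (u + c) (-1) b') as (b & b' & Hb & Hright & Hleft).
  { exists b, b'. split; [easy|].
    split; now apply (lower_slope_ext (Kr Q) _ (u + c)). }
  destruct (Req_dec (u + c) 0) as [Huc|Huc].
  - rewrite Huc. rewrite <- Hper, Huc in Hu.
    destruct (kernel_node_kink Q SQ Hu) as (s & Hs & Hkink).
    exists s, s. split; [lra|]. split; apply Hkink; [now left|now right].
  - destruct (HdQ (u + c)) as [Hd _]; [unfold in_open; lra|].
    exists (1 * dQ (u + c) - eps / 2), (-1 * dQ (u + c) - eps / 2).
    split; [lra|]. split; apply is_derive_lower_slope; auto; lra.
Qed.

Lemma lderiv_m_infty_lower_slope (K : R -> Rbar) (d : R -> R) (b : R) :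
  concave_kernel K -> is_finite (K 0) ->
  (forall t, in_open t -> is_lderiv (Kr K) t (d t)) ->
  filterlim d (at_left (2 * PI)) (Rbar_locally m_infty) -> lower_slope (Kr K) 0 (-1) b.
Proof.
  intros HK Hfin Hd Hlim. pose proof two_PI_pos as HP.
  assert (Hin : at_right 0 in_open) by now apply (locally_at_right _ 0 (2 * PI)).
  assert (Hleft : filterlim (fun h => - h + 2 * PI) (at_right 0) (at_left (2 * PI))).
  { apply (filterlim_comp _ _ _ Ropp (fun t => t + 2 * PI) _ (at_left 0)).
    - rewrite <- Ropp_0 at 2. apply filterlim_Ropp_right.
    - apply filterlim_shift_at_left. ring. }
  assert (Hdlt : at_right 0 (fun h => d (- h + 2 * PI) < - b))
    by (apply (filterlim_comp _ _ _ _ d _ _ _ Hleft Hlim (fun x => x < - b)); now exists (- b)).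
  generalize (filter_and _ _ Hin Hdlt). unfold lower_slope. apply filter_imp.
  intros h [Hh Hdh]. unfold in_open in Hh.
  assert (Ht : in_open (- h + 2 * PI)) by (unfold in_open; lra).
  assert (Hs : slope (Kr K) (- h + 2 * PI) (2 * PI) <= d (- h + 2 * PI)).
  { apply (slope_le_concave_lderiv (kernel_dom K));
      [|now apply kernel_dom_2PI|lra| |now apply Hd].
    - now apply kernel_concave_on_dom.
    - now apply locally_kernel_dom. }
  unfold slope in Hs. replace (2 * PI - (- h + 2 * PI)) with h in Hs by ring.
  assert (Hper : forall t, Kr K (t + 2 * PI) = Kr K t)
    by (intros t; unfold Kr; now rewrite (kernel_periodic K HK)).
  replace (Kr K (2 * PI)) with (Kr K 0) in Hs by (rewrite <- Hper; f_equal; ring).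
  rewrite Hper in Hs.
  replace (0 + h * -1) with (- h) by ring.
  assert (Hlt : (Kr K 0 - Kr K (- h)) / h < - b) by lra.
  apply Rlt_div_l in Hlt; lra.
Qed.

Lemma rderiv_p_infty_lower_slope (K : R -> Rbar) (d : R -> R) (b : R) :
  concave_kernel K -> is_finite (K 0) ->
  (forall t, in_open t -> is_rderiv (Kr K) t (d t)) ->
  filterlim d (at_right 0) (Rbar_locally p_infty) -> lower_slope (Kr K) 0 1 b.
Proof.
  intros HK Hfin Hd Hlim. pose proof two_PI_pos as HP.
  assert (Hin : at_right 0 in_open) by now apply (locally_at_right _ 0 (2 * PI)).
  assert (Hdgt : at_right 0 (fun h => b < d h)) by (apply (Hlim (fun x => b < x)); now exists b).
  generalize (filter_and _ _ Hin Hdgt). unfold lower_slope. apply filter_imp.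
  intros h [Hh Hdh].
  assert (Hs : d h <= slope (Kr K) h 0).
  { apply (concave_rderiv_le_slope (kernel_dom K));
      [|now apply kernel_dom_0|apply Hh| |now apply Hd].
    - now apply kernel_concave_on_dom.
    - now apply locally_kernel_dom. }
  unfold in_open in Hh. unfold slope in Hs.
  replace ((Kr K 0 - Kr K h) / (0 - h)) with ((Kr K h - Kr K 0) / h) in Hs by (field; lra).
  rewrite Rmult_1_r, Rplus_0_l.
  assert (Hlt : b < (Kr K h - Kr K 0) / h) by lra.
  apply Rlt_div_r in Hlt; lra.
Qed.

Lemma cond_infty'_lower_slope (K : R -> Rbar) :
  concave_kernel K -> cond_infty' K -> is_finite (K 0) ->
  exists e, direction e /\ forall b, lower_slope (Kr K) 0 e b.
Proof.
  intros HK [(dm & dp & Hd & Hlim & _)|(dm & dp & Hd & _ & Hlim)] Hfin.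
  - exists (-1). split; [now right|]. intros b.
    apply (lderiv_m_infty_lower_slope K dm); auto. intros t Ht. now apply Hd.
  - exists 1. split; [now left|]. intros b.
    apply (rderiv_p_infty_lower_slope K dp); auto. intros t Ht. now apply Hd.
Qed.

(** * Sums of translates *)

(* [L] plays the part of the kernel of an additional node with index [0], which is fixed at [0]. *)
Definition kernel_at (L K : R -> Rbar) (i : nat) : R -> Rbar :=
  match i with O => L | S _ => K end.

Definition node (y : nat -> R) (i : nat) : R := match i with O => 0 | S _ => y i end.

Lemma Rbar_ge_finite (M : R) (x : Rbar) :
  Rbar_le M x -> x <> p_infty -> is_finite x.
Proof. now destruct x. Qed.

Lemma is_finite_Rbar_plus (x y : Rbar) :
  x <> p_infty -> y <> p_infty -> is_finite (Rbar_plus x y) <-> is_finite x /\ is_finite y.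
Proof. intros Hx Hy. destruct x, y; simpl; split; intros Hfin; try easy; now destruct Hfin. Qed.

Lemma perm_on_Permutation (n : nat) (s : nat -> nat) :
  perm_on n s -> Permutation (map s (seq 1 n)) (seq 1 n).
Proof.
  intros [Hrange Hinj]. apply NoDup_Permutation_bis.
  - apply NoDup_map_NoDup_ForallPairs; [|apply seq_NoDup].
    intros i j Hi Hj. apply in_seq in Hi, Hj. apply Hinj; lia.
  - rewrite length_map. lia.
  - intros j Hj. apply in_map_iff in Hj as (i & <- & Hi). apply in_seq in Hi.
    specialize (Hrange i). apply in_seq. lia.
Qed.

Section SumOfTranslates.

Variables L K : R -> Rbar.
Hypotheses (HL : concave_kernel L) (HK : concave_kernel K).

Lemma concave_kernel_at (i : nat) : concave_kernel (kernel_at L K i).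
Proof. now destruct i. Qed.

Lemma F_0 (y : nat -> R) (t : R) : F L K 0 y t = L t.
Proof. apply Rbar_plus_0_r. Qed.

Lemma sumK_not_p_infty (n : nat) (y : nat -> R) (t : R) : sumK K y t n <> p_infty.
Proof.
  induction n as [|n IH]; [easy|].
  apply Rbar_plus_not_p_infty; [easy|now apply kernel_not_p_infty].
Qed.

Lemma F_not_p_infty (n : nat) (y : nat -> R) (t : R) : F L K n y t <> p_infty.
Proof. apply Rbar_plus_not_p_infty; [now apply kernel_not_p_infty|apply sumK_not_p_infty]. Qed.

Lemma F_succ (n : nat) (y : nat -> R) (t : R) :
  F L K (S n) y t = Rbar_plus (F L K n y t) (K (t - y (S n))).
Proof.
  assert (HLt := kernel_not_p_infty L HL t).
  assert (Hsum := sumK_not_p_infty n y t).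
  assert (HKt := kernel_not_p_infty K HK (t - y (S n))).
  unfold F. simpl.
  destruct (L t), (sumK K y t n), (K (t - y (S n))); simpl; try congruence.
  f_equal. ring.
Qed.

Lemma exp_F_succ (n : nat) (y : nat -> R) (t : R) :
  exp_Rbar (F L K (S n) y t) = exp_Rbar (F L K n y t) * exp_Rbar (K (t - y (S n))).
Proof.
  rewrite F_succ. apply exp_Rbar_plus; [apply F_not_p_infty|now apply kernel_not_p_infty].
Qed.

Lemma F_finite_iff (n : nat) (y : nat -> R) (t : R) :
  is_finite (F L K n y t) <->
  forall i, (i <= n)%nat -> is_finite (kernel_at L K i (t - node y i)).
Proof.
  induction n as [|n IH].
  - rewrite F_0. split; intros H.
    + intros i Hi. replace i with 0%nat by lia. simpl. now rewrite Rminus_0_r.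
    + specialize (H 0%nat (le_n 0)). simpl in H. now rewrite Rminus_0_r in H.
  - rewrite F_succ, is_finite_Rbar_plus, IH
      by (apply F_not_p_infty || now apply kernel_not_p_infty).
    split; [intros [H HS] i Hi|intros H; split; [intros; apply H; lia|now apply (H (S n))]].
    destruct (Nat.eq_dec i (S n)) as [->|]; [easy|apply H; lia].
Qed.

Lemma F_eq_sum (n : nat) (y : nat -> R) (t : R) :
  is_finite (F L K n y t) ->
  F L K n y t = Finite (sum_f_R0 (fun i => Kr (kernel_at L K i) (t - node y i)) n).
Proof.
  induction n as [|n IH]; intros Hfin.
  - rewrite F_0 in *. simpl. now rewrite Rminus_0_r, <- Hfin.
  - rewrite F_succ in *. apply is_finite_Rbar_plus in Hfin as [Hn HSn];
      [|apply F_not_p_infty|now apply kernel_not_p_infty].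
    rewrite (IH Hn), <- HSn. reflexivity.
Qed.

Lemma F_periodic (n : nat) (y : nat -> R) : periodic (F L K n y).
Proof.
  intros t. induction n as [|n IH]; [rewrite !F_0; now apply kernel_periodic|].
  rewrite !F_succ, IH. f_equal.
  replace (t + 2 * PI - y (S n)) with (t - y (S n) + 2 * PI) by ring. now apply kernel_periodic.
Qed.

Lemma F_representative (n : nat) (y : nat -> R) (t : R) :
  exists t', 0 <= t' < 2 * PI /\ F L K n y t' = F L K n y t.
Proof.
  destruct (period_shift_exists t) as (c & Hc & Hper). exists (t + c).
  split; [easy|apply Hper, F_periodic].
Qed.

Lemma F_node_representative (n : nat) (y : nat -> R) :
  exists y', inT n y' /\ forall t, F L K n y' t = F L K n y t.
Proof.
  destruct (functional_choice (fun i c => 0 <= y i + c < 2 * PI /\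
    forall (A : Type) (f : R -> A), periodic f -> forall t, f (t + c) = f t)) as [c Hc].
  { intros i. apply period_shift_exists. }
  exists (fun i => y i + c i). split; [intros i Hi; apply Hc|].
  intros t. induction n as [|n IH]; [now rewrite !F_0|]. rewrite !F_succ, IH. f_equal.
  destruct (Hc (S n)) as [_ Hper].
  rewrite <- (Hper _ K (kernel_periodic K HK) (t - (y (S n) + c (S n)))). f_equal; ring.
Qed.

Lemma F_ext (n : nat) (y y' : nat -> R) (t : R) :
  (forall i, (1 <= i <= n)%nat -> y i = y' i) -> F L K n y t = F L K n y' t.
Proof.
  induction n as [|n IH]; intros Hy; [now rewrite !F_0|].
  rewrite !F_succ, IH, Hy; [easy|lia|intros; apply Hy; lia].
Qed.

Lemma F_le_iff_exp (n m : nat) (y y' : nat -> R) (t t' : R) :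
  Rbar_le (F L K n y t) (F L K m y' t') <->
  exp_Rbar (F L K n y t) <= exp_Rbar (F L K m y' t').
Proof. apply exp_Rbar_le; apply F_not_p_infty. Qed.

Lemma filterlim_exp_F {T : Type} (Fl : (T -> Prop) -> Prop) {FF : Filter Fl}
  (n : nat) (y : T -> nat -> R) (w : nat -> R) (t : T -> R) (t0 : R) :
  (forall i, (1 <= i <= n)%nat -> filterlim (fun x => y x i) Fl (locally (w i))) ->
  filterlim t Fl (locally t0) ->
  filterlim (fun x => exp_Rbar (F L K n (y x) (t x))) Fl (locally (exp_Rbar (F L K n w t0))).
Proof.
  intros Hy Ht. induction n as [|n IH].
  - rewrite F_0. apply (filterlim_ext (fun x => exp_Rbar (L (t x)))); [intros; now rewrite F_0|].
    apply (filterlim_comp _ _ _ t (fun u => exp_Rbar (L u)) _ (locally t0)); [easy|].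
    now apply exp_kernel_continuous.
  - rewrite exp_F_succ.
    apply (filterlim_ext
      (fun x => exp_Rbar (F L K n (y x) (t x)) * exp_Rbar (K (t x - y x (S n)))));
      [intros; now rewrite exp_F_succ|].
    apply (filterlim_comp_2 (G := locally (exp_Rbar (F L K n w t0)))
                            (H := locally (exp_Rbar (K (t0 - w (S n))))));
      [apply IH; intros; apply Hy; lia| |apply (filterlim_mult (K := R_AbsRing))].
    apply (filterlim_comp _ _ _ (fun x => t x - y x (S n)) (fun u => exp_Rbar (K u)) _
      (locally (t0 - w (S n)))); [|now apply exp_kernel_continuous].
    apply (filterlim_comp_2 t (fun x => - y x (S n)) Rplus (G := locally t0)
                            (H := locally (- w (S n))));
      [easy| |apply (filterlim_plus (V := R_NormedModule))].
    apply (filterlim_comp _ _ _ (fun x => y x (S n)) Ropp _ (locally (w (S n))));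
      [apply Hy; lia|apply (filterlim_opp (V := R_NormedModule))].
Qed.

Lemma exp_F_continuous (n : nat) (y : nat -> R) (t : R) :
  continuous (fun u => exp_Rbar (F L K n y u)) t.
Proof.
  apply (filterlim_exp_F (locally t) n (fun _ => y) y (fun u => u) t);
    [intros; apply filterlim_const|apply filterlim_id].
Qed.

Lemma F_max_interval (n : nat) (y : nat -> R) (a b : R) :
  a <= b ->
  exists z, a <= z <= b /\ forall t, a <= t <= b -> Rbar_le (F L K n y t) (F L K n y z).
Proof.
  intros Hab.
  destruct (continuity_ab_maj (fun t => exp_Rbar (F L K n y t)) a b Hab) as (z & Hmax & Hz).
  - intros c _. apply continuity_pt_filterlim, exp_F_continuous.
  - exists z. split; [easy|]. intros t Ht. now apply F_le_iff_exp, Hmax.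
Qed.

Lemma F_max (n : nat) (y : nat -> R) :
  exists z, 0 <= z < 2 * PI /\ forall t, Rbar_le (F L K n y t) (F L K n y z).
Proof.
  pose proof two_PI_pos as HP.
  destruct (F_max_interval n y 0 (2 * PI)) as (z & _ & Hmax); [lra|].
  destruct (F_representative n y z) as (z' & Hz' & Ez).
  exists z'. split; [easy|]. intros t.
  destruct (F_representative n y t) as (t' & Ht' & <-).
  rewrite Ez. apply Hmax. lra.
Qed.

Lemma F_ge_limit (n : nat) (y : nat -> nat -> R) (w : nat -> R) (t : nat -> R) (t0 M : R) :
  (forall i, (1 <= i <= n)%nat -> is_lim_seq (fun k => y k i) (w i)) -> is_lim_seq t t0 ->
  (forall k, Rbar_le M (F L K n (y k) (t k))) -> Rbar_le M (F L K n w t0).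
Proof.
  intros Hy Ht HM. apply exp_Rbar_le; [easy|apply F_not_p_infty|].
  apply (is_lim_seq_le (fun _ => exp M) (fun k => exp_Rbar (F L K n (y k) (t k)))
    (exp M) (exp_Rbar (F L K n w t0))).
  - intros k. apply (exp_Rbar_le M); [easy|apply F_not_p_infty|apply HM].
  - apply is_lim_seq_const.
  - now apply (filterlim_exp_F eventually).
Qed.

Lemma F_locally_finite (n : nat) (y : nat -> R) (t : R) :
  is_finite (F L K n y t) -> locally t (fun u => is_finite (F L K n y u)).
Proof.
  intros Ht. apply is_finite_exp_Rbar in Ht.
  generalize (exp_F_continuous n y t _ (open_gt 0 _ Ht)).
  unfold filtermap. apply filter_imp. intros u. apply is_finite_exp_Rbar.
Qed.

Lemma F_increases_of_lower_slopes (n : nat) (y : nat -> R) (c e : R) (b : nat -> R) :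
  is_finite (F L K n y c) ->
  (forall i, (i <= n)%nat -> lower_slope (Kr (kernel_at L K i)) (c - node y i) e (b i)) ->
  0 < sum_f_R0 b n -> exists t, Rbar_lt (F L K n y c) (F L K n y t).
Proof.
  intros Hc Hb Hpos.
  assert (Hsum : lower_slope (fun t => sum_f_R0 (fun i => Kr (kernel_at L K i) (t - node y i)) n)
                   c e (sum_f_R0 b n)).
  { apply (lower_slope_sum (fun i t => Kr (kernel_at L K i) (t - node y i))).
    intros i Hi. apply (lower_slope_ext (Kr (kernel_at L K i)) _ (c - node y i)); [|now apply Hb].
    intros h. f_equal. ring. }
  destruct (lower_slope_pos_increases _ _ _ _ _ Hsum Hpos (F_locally_finite n y c Hc))
    as (t & Ht & Hlt).
  exists t. now rewrite !F_eq_sum.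
Qed.

Lemma exp_F_fold_right (n : nat) (y : nat -> R) (t : R) :
  exp_Rbar (F L K n y t) =
  exp_Rbar (L t) * fold_right Rmult 1 (map (fun i => exp_Rbar (K (t - y i))) (seq 1 n)).
Proof.
  assert (Happ : forall l a, fold_right Rmult 1 (l ++ a :: nil) = fold_right Rmult 1 l * a).
  { intros l a. induction l as [|b l IH]; simpl; [|rewrite IH]; ring. }
  induction n as [|n IH]; [rewrite F_0; simpl; ring|].
  rewrite exp_F_succ, IH, seq_S, map_app. simpl. rewrite Happ. ring.
Qed.

Lemma F_permute (n : nat) (y : nat -> R) (s : nat -> nat) (t : R) :
  perm_on n s -> F L K n (fun i => y (s i)) t = F L K n y t.
Proof.
  intros Hs. apply perm_on_Permutation in Hs.
  assert (Hexp : exp_Rbar (F L K n (fun i => y (s i)) t) = exp_Rbar (F L K n y t)).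
  { rewrite !exp_F_fold_right, <- (map_map s (fun i => exp_Rbar (K (t - y i)))). f_equal.
    induction (Permutation_map (fun i => exp_Rbar (K (t - y i))) Hs); simpl; try congruence; ring. }
  apply Rbar_le_antisym; apply F_le_iff_exp; rewrite Hexp; lra.
Qed.

End SumOfTranslates.

(** * Nodes are not maximum points *)

Section NodeNotMax.

Variables (L K : R -> Rbar) (n : nat) (w : nat -> R) (k : nat).
Hypotheses (SL : strictly_concave_kernel L) (SK : strictly_concave_kernel K).
Hypotheses (Hk : (1 <= k <= n)%nat) (Hfin : is_finite (F L K n w (w k))).

Let HL : concave_kernel L := proj1 SL.
Let HK : concave_kernel K := proj1 SK.

Lemma kernel_at_node_finite (i : nat) :
  (i <= n)%nat -> is_finite (kernel_at L K i (w k - node w i)).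
Proof. now apply F_finite_iff. Qed.

Lemma kernel_finite_at_own_node : is_finite (K 0).
Proof.
  assert (H := kernel_at_node_finite k ltac:(lia)).
  destruct k as [|k']; [lia|]. simpl in H. now rewrite Rminus_diag in H.
Qed.

Lemma lower_slope_own_node (e b : R) :
  lower_slope (Kr K) 0 e b -> lower_slope (Kr (kernel_at L K k)) (w k - node w k) e b.
Proof. destruct k as [|k']; [lia|]. simpl. now rewrite Rminus_diag. Qed.

(* One of the one-sided slopes of [K] at its node is infinite and dominates all other slopes. *)
Lemma node_not_max_cond_infty' :
  cond_infty' K -> exists t, Rbar_lt (F L K n w (w k)) (F L K n w t).
Proof.
  intros Hcond.
  destruct (cond_infty'_lower_slope K HK Hcond kernel_finite_at_own_node) as (e & He & Hinf).
  destruct (functional_choice (fun i b => (i <= n)%nat ->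
    lower_slope (Kr (kernel_at L K i)) (w k - node w i) e b)) as [b Hb].
  { intros i. destruct (classic (i <= n)%nat) as [Hi|Hi]; [|now exists 0].
    destruct (kernel_lower_slope (kernel_at L K i) (w k - node w i) e) as [b Hb];
      [now apply concave_kernel_at|now apply kernel_at_node_finite|easy|now exists b]. }
  pose (A := 1 + sum_f_R0 (fun i => Rabs (b i)) n).
  pose (b' := fun i => if Nat.eqb i k then A else b i).
  apply (F_increases_of_lower_slopes L K HL HK n w (w k) e b' Hfin).
  - intros i Hi. unfold b'.
    destruct (Nat.eqb_spec i k) as [->|_]; [now apply lower_slope_own_node|now apply Hb].
  - assert (Hsum : b' k + Rabs (b k) <= sum_f_R0 (fun i => b' i + Rabs (b i)) n).
    { apply (sum_ge_term (fun i => b' i + Rabs (b i))); [|lia]. intros i _. unfold b'.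
      destruct (Nat.eqb i k); [|pose proof (Rabs_maj2 (b i)); lra].
      assert (0 <= sum_f_R0 (fun i => Rabs (b i)) n)
        by (apply cond_pos_sum; intros; apply Rabs_pos).
      pose proof (Rabs_pos (b i)). unfold A. lra. }
    rewrite plus_sum in Hsum. pose proof (Rabs_pos (b k)).
    unfold b' at 1 in Hsum. rewrite Nat.eqb_refl in Hsum. unfold A in Hsum. lra.
Qed.

(* The kink of [K] at its node is not compensated by the other, differentiable, terms; where these
   are at a node themselves, their kinks point the same way. *)
Lemma node_not_max_C1 :
  C1_open K -> C1_open L -> exists t, Rbar_lt (F L K n w (w k)) (F L K n w t).
Proof.
  intros CK CL.
  destruct (kernel_node_kink K SK kernel_finite_at_own_node) as (s & Hs & Hkink).
  assert (Hn : 0 < INR (S n)) by (apply lt_0_INR; lia).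
  pose (eps := s / INR (S n)). assert (Heps : 0 < eps) by now apply Rdiv_lt_0_compat.
  destruct (functional_choice (fun i (p : R * R) => (i <= n)%nat ->
    (if Nat.eqb i k then s + s else - eps) <= fst p + snd p /\
    lower_slope (Kr (kernel_at L K i)) (w k - node w i) 1 (fst p) /\
    lower_slope (Kr (kernel_at L K i)) (w k - node w i) (-1) (snd p))) as [b Hb].
  { intros i. destruct (classic (i <= n)%nat) as [Hi|Hi]; [|now exists (0, 0)].
    destruct (Nat.eqb_spec i k) as [->|_].
    - exists (s, s). intros _. split; [simpl; lra|].
      split; apply lower_slope_own_node, Hkink; [now left|now right].
    - destruct (C1_kernel_lower_slopes (kernel_at L K i) (w k - node w i) eps) as (b & b' & Hb);
        [now destruct i|now destruct i|now apply kernel_at_node_finite|easy|now exists (b, b')]. }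
  assert (Hsum : fst (b k) + snd (b k) + eps <= sum_f_R0 (fun i => fst (b i) + snd (b i) + eps) n).
  { apply (sum_ge_term (fun i => fst (b i) + snd (b i) + eps)); [|lia].
    intros i Hi. destruct (Hb i Hi) as [H _]. destruct (Nat.eqb i k); lra. }
  rewrite !plus_sum, sum_cte in Hsum.
  destruct (Hb k ltac:(lia)) as [Hbk _]. rewrite Nat.eqb_refl in Hbk.
  assert (Es : eps * INR (S n) = s) by (unfold eps; field; lra).
  destruct (Rlt_or_le 0 (sum_f_R0 (fun i => fst (b i)) n)) as [Hpos|Hneg].
  - apply (F_increases_of_lower_slopes L K HL HK n w (w k) 1 (fun i => fst (b i)) Hfin); [|easy].
    intros i Hi. now apply Hb.
  - apply (F_increases_of_lower_slopes L K HL HK n w (w k) (-1) (fun i => snd (b i)) Hfin); [|lra].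
    intros i Hi. now apply Hb.
Qed.

End NodeNotMax.

(** * Existence of a minimax configuration *)

Lemma is_lim_seq_along (u : nat -> R) (l : Rbar) (phi : nat -> nat) :
  (forall k, (k <= phi k)%nat) -> is_lim_seq u l -> is_lim_seq (fun k => u (phi k)) l.
Proof.
  intros Hphi Hu. apply (is_lim_seq_subseq u l phi); [|easy].
  intros P [N HN]. exists N. intros k Hk. apply HN. specialize (Hphi k). lia.
Qed.

Lemma is_lim_seq_RinvN : is_lim_seq RinvN 0.
Proof. apply is_lim_seq_Reals, RinvN_cv. Qed.

Lemma bounded_subsequence (u : nat -> R) (a b : R) :
  (forall k, a <= u k <= b) ->
  exists (phi : nat -> nat) (l : R),
    (forall k, (k <= phi k)%nat) /\ a <= l <= b /\ is_lim_seq (fun k => u (phi k)) l.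
Proof.
  intros Hu.
  destruct (Bolzano_Weierstrass u (fun c => a <= c <= b) (compact_P3 a b) Hu) as [l Hl].
  destruct (functional_choice (fun k p => (k <= p)%nat /\ Rabs (u p - l) < RinvN k)) as [phi Hphi].
  { intros k. destruct (Hl (disc l (RinvN k)) k) as (p & Hp & Hd); [now exists (RinvN k)|].
    now exists p. }
  assert (Hlim : is_lim_seq (fun k => u (phi k)) l).
  { apply is_lim_seq_spec. intros eps.
    generalize (proj2 (is_lim_seq_spec _ _) is_lim_seq_RinvN eps). apply filter_imp. intros k Hk.
    rewrite Rminus_0_r, Rabs_pos_eq in Hk by apply Rlt_le, cond_pos.
    apply Rlt_trans with (2 := Hk), Hphi. }
  exists phi, l. split; [apply Hphi|]. split; [split|easy].
  - apply (is_lim_seq_le (fun _ => a) (fun k => u (phi k)) a l);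
      [intros; apply Hu|apply is_lim_seq_const|easy].
  - apply (is_lim_seq_le (fun k => u (phi k)) (fun _ => b) l b);
      [intros; apply Hu|easy|apply is_lim_seq_const].
Qed.

Lemma bounded_subsequence_vec (n : nat) (u : nat -> nat -> R) (a b : R) :
  (forall k i, (1 <= i <= n)%nat -> a <= u k i <= b) ->
  exists (phi : nat -> nat) (l : nat -> R), (forall k, (k <= phi k)%nat) /\
    forall i, (1 <= i <= n)%nat -> a <= l i <= b /\ is_lim_seq (fun k => u (phi k) i) (l i).
Proof.
  induction n as [|n IH]; intros Hu.
  - exists (fun k => k), (fun _ => 0). split; [easy|]. intros; lia.
  - destruct IH as (phi & l & Hphi & Hl); [intros k i Hi; apply Hu; lia|].
    destruct (bounded_subsequence (fun k => u (phi k) (S n)) a b) as (psi & l0 & Hpsi & Hl0 & Hlim).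
    { intros k; apply Hu; lia. }
    exists (fun k => phi (psi k)), (extend n l l0). split.
    + intros k. specialize (Hphi (psi k)). specialize (Hpsi k). lia.
    + intros i Hi. destruct (Nat.eq_dec i (S n)) as [->|]; [now rewrite extend_succ|].
      rewrite extend_le by lia. destruct (Hl i) as [Hli Hlimi]; [lia|].
      split; [easy|]. now apply (is_lim_seq_along (fun k => u (phi k) i)).
Qed.

Lemma least_level_attained (n : nat) (a b lo : R) (P : R -> (nat -> R) -> Prop) :
  let box := fun y : nat -> R => forall i, (1 <= i <= n)%nat -> a <= y i <= b in
  (exists c y, box y /\ P c y) -> (forall c y, P c y -> lo <= c) ->
  (forall (cs : nat -> R) (ys : nat -> nat -> R) (c : R) (y : nat -> R),
     (forall k, P (cs k) (ys k)) -> is_lim_seq cs c ->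
     (forall i, (1 <= i <= n)%nat -> is_lim_seq (fun k => ys k i) (y i)) -> P c y) ->
  exists c w, box w /\ P c w /\ forall c' y, box y -> P c' y -> c <= c'.
Proof.
  intros box (c0 & y0 & Hbox0 & HP0) Hlo Hclosed.
  pose (level := fun c => exists y, box y /\ P c y).
  destruct (Glb_Rbar_correct level) as [Hlb Hglb].
  assert (Hlo' : Rbar_le lo (Glb_Rbar level)).
  { apply Hglb. intros c (y & _ & Hy). now apply (Hlo c y). }
  assert (Hc0 : Rbar_le (Glb_Rbar level) c0) by (apply Hlb; now exists y0).
  destruct (Glb_Rbar level) as [m| |]; try easy.
  destruct (functional_choice (fun k (p : R * (nat -> R)) =>
    m <= fst p < m + RinvN k /\ box (snd p) /\ P (fst p) (snd p))) as [p Hp].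
  { intros k. apply NNPP. intros Hno. assert (Hk := cond_pos (RinvN k)).
    enough (m + RinvN k <= m) by lra. apply (Hglb (m + RinvN k)). intros c (y & Hy & Hc).
    apply Rnot_lt_le. intros Hlt. apply Hno. exists (c, y).
    simpl. split; [split; [apply (Hlb c); now exists y|easy]|now split]. }
  destruct (bounded_subsequence_vec n (fun k => snd (p k)) a b) as (phi & w & Hphi & Hw).
  { intros k i Hi. now apply Hp. }
  exists m, w. split; [intros i Hi; now apply Hw|].
  split; [|intros c y Hy Hc; apply (Hlb c); now exists y].
  apply (Hclosed (fun k => fst (p (phi k))) (fun k => snd (p (phi k)))); [intros k; apply Hp| |].
  - apply (is_lim_seq_along (fun k => fst (p k)) m phi Hphi).
    apply (is_lim_seq_le_le (fun _ => m) _ (fun k => m + RinvN k)).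
    + intros k. destruct (Hp k) as [Hpk _]. lra.
    + apply is_lim_seq_const.
    + replace (Finite m) with (Finite (m + 0)) by (f_equal; ring).
      apply is_lim_seq_plus'; [apply is_lim_seq_const|apply is_lim_seq_RinvN].
  - intros i Hi. now apply Hw.
Qed.

Definition minimax (L K : R -> Rbar) (n : nat) (M : R) (w : nat -> R) : Prop :=
  (forall t, Rbar_le (F L K n w t) M) /\ forall y, exists t, Rbar_le M (F L K n y t).

Lemma kernel_finite_off_node (Q : R -> Rbar) (u : R) :
  concave_kernel Q -> - (2 * PI) < u < 2 * PI -> u <> 0 -> is_finite (Q u).
Proof.
  intros HQ Hu Hne. destruct (Rlt_or_le u 0) as [H|H].
  - rewrite <- (kernel_periodic Q HQ). apply in_open_kernel_dom; [easy|unfold in_open; lra].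
  - apply in_open_kernel_dom; [easy|unfold in_open; lra].
Qed.

Lemma F_finite_somewhere (L K : R -> Rbar) (n : nat) (w : nat -> R) :
  concave_kernel L -> concave_kernel K ->
  (forall i, (1 <= i <= n)%nat -> 0 <= w i <= 2 * PI) -> exists t, is_finite (F L K n w t).
Proof.
  intros HL HK Hw.
  enough (Hev : at_right 0 (fun t => forall i, (i <= n)%nat ->
                              is_finite (kernel_at L K i (t - node w i)))).
  { destruct (filter_ex _ Hev) as [t Ht]. exists t. now apply F_finite_iff. }
  apply filter_forall_upto. intros i Hi. pose proof two_PI_pos as HP.
  assert (Hnode : 0 <= node w i <= 2 * PI) by (destruct i; simpl; [lra|apply Hw; lia]).
  assert (Hgap : exists r, 0 < r <= 2 * PI /\ forall t, 0 < t < r -> t <> node w i).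
  { destruct (Req_dec (node w i) 0) as [Hnode0|Hnode0].
    - exists (2 * PI). split; [lra|]. intros t Ht. lra.
    - exists (node w i). split; [lra|]. intros t Ht. lra. }
  destruct Hgap as (r & Hr & Hne). apply (locally_at_right _ 0 r); [lra|]. intros t Ht.
  apply kernel_finite_off_node; [now apply concave_kernel_at|lra|].
  specialize (Hne t Ht). lra.
Qed.

Lemma minimax_exists (L K : R -> Rbar) (n : nat) :
  concave_kernel L -> concave_kernel K -> exists M w, inT n w /\ minimax L K n M w.
Proof.
  intros HL HK.
  destruct (least_level_attained n 0 (2 * PI) 0
    (fun c y => forall t, exp_Rbar (F L K n y t) <= c)) as (m & w0 & Hw0 & Hm & Hleast).
  - destruct (F_max L K HL HK n (fun _ => 0)) as (z & _ & Hz).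
    exists (exp_Rbar (F L K n (fun _ => 0) z)), (fun _ => 0).
    split; [intros i _; pose proof two_PI_pos; lra|]. intros t. now apply F_le_iff_exp.
  - intros c y Hc. apply Rle_trans with (2 := Hc 0), exp_Rbar_ge0.
  - intros cs ys c y Hle Hc Hy t.
    apply (is_lim_seq_le (fun k => exp_Rbar (F L K n (ys k) t)) cs (exp_Rbar (F L K n y t)) c);
      [intros k; apply Hle| |easy].
    apply (filterlim_exp_F L K HL HK eventually n ys y (fun _ => t) t); [exact Hy|].
    apply filterlim_const.
  - assert (Hm0 : 0 < m).
    { destruct (F_finite_somewhere L K n w0 HL HK Hw0) as [t Ht].
      apply is_finite_exp_Rbar in Ht. specialize (Hm t). lra. }
    destruct (F_node_representative L K HL HK n w0) as (w & Hw & Ew).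
    exists (ln m), w. split; [easy|]. split.
    + intros t. apply exp_Rbar_le; [now apply F_not_p_infty|easy|].
      rewrite Ew. simpl. now rewrite exp_ln.
    + intros y. destruct (F_node_representative L K HL HK n y) as (y' & Hy' & Ey).
      destruct (F_max L K HL HK n y') as (z & _ & Hz). exists z. rewrite <- Ey.
      apply (exp_Rbar_le (ln m)); [easy|now apply F_not_p_infty|].
      simpl. rewrite exp_ln by easy. apply (Hleast _ y').
      * intros i Hi. specialize (Hy' i Hi). lra.
      * intros t. now apply F_le_iff_exp.
Qed.

(** * Arcs and supporting functionals *)

Definition sorted_nodes (n : nat) (v : nat -> R) : Prop :=
  forall k, (k <= n)%nat -> ext n v k <= ext n v (S k).

Definition on_arc (n : nat) (v : nat -> R) (j : nat) (t : R) : Prop :=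
  ext n v j <= t <= ext n v (S j).

(* [arc_shift j i] brings [t - v i] back to [[0, 2 PI]] when [t] is on the [j]-th arc of a sorted
   [v]. *)
Definition arc_shift (j i : nat) : R := if (i <=? j)%nat then 0 else 2 * PI.

Definition in_arc_cell (n j : nat) (v : nat -> R) (t : R) : Prop :=
  forall i, (i <= n)%nat -> 0 <= t - node v i + arc_shift j i <= 2 * PI.

Lemma ext_node (n : nat) (v : nat -> R) (i : nat) : (i <= n)%nat -> ext n v i = node v i.
Proof.
  intros Hi. unfold ext. destruct i as [|i]; [easy|]. simpl.
  destruct (Nat.eqb_spec i n); [lia|easy].
Qed.

Lemma ext_last (n : nat) (v : nat -> R) : ext n v (S n) = 2 * PI.
Proof. unfold ext. simpl. now rewrite Nat.eqb_refl. Qed.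

Lemma sorted_nodes_le (n : nat) (v : nat -> R) (i j : nat) :
  sorted_nodes n v -> (i <= j <= S n)%nat -> ext n v i <= ext n v j.
Proof.
  intros Hs [Hij Hj]. induction Hij as [|j Hij IH]; [lra|].
  apply Rle_trans with (ext n v j); [apply IH; lia|apply Hs; lia].
Qed.

Lemma sorted_nodes_range (n : nat) (v : nat -> R) (i : nat) :
  sorted_nodes n v -> (i <= S n)%nat -> 0 <= ext n v i <= 2 * PI.
Proof.
  intros Hs Hi. rewrite <- (ext_last n v). change 0 with (ext n v 0).
  split; apply sorted_nodes_le; auto; lia.
Qed.

Lemma on_arc_exists (n : nat) (v : nat -> R) (t : R) :
  0 <= t <= 2 * PI -> exists j, (j <= n)%nat /\ on_arc n v j t.
Proof.
  intros Ht.
  assert (Hfind : forall p, t <= ext n v (S p) -> exists j, (j <= p)%nat /\ on_arc n v j t).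
  { induction p as [|p IH]; intros Hp; [now exists 0%nat|].
    destruct (Rle_or_lt t (ext n v (S p))) as [H|H].
    - destruct (IH H) as (j & Hj & Harc). exists j. split; [lia|easy].
    - exists (S p). split; [lia|]. split; [lra|easy]. }
  apply Hfind. rewrite ext_last. lra.
Qed.

Lemma on_arc_in_cell (n : nat) (v : nat -> R) (j : nat) (t : R) :
  sorted_nodes n v -> (j <= n)%nat -> on_arc n v j t -> in_arc_cell n j v t.
Proof.
  intros Hs Hj [Hjt HtS] i Hi. rewrite <- (ext_node n) by easy.
  pose proof (sorted_nodes_range n v j Hs ltac:(lia)).
  pose proof (sorted_nodes_range n v (S j) Hs ltac:(lia)).
  pose proof (sorted_nodes_range n v i Hs ltac:(lia)).
  unfold arc_shift. destruct (Nat.leb_spec i j) as [Hij|Hij].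
  - pose proof (sorted_nodes_le n v i j Hs ltac:(lia)). lra.
  - pose proof (sorted_nodes_le n v (S j) i Hs ltac:(lia)). lra.
Qed.

Lemma periodic_arc_shift {A : Type} (f : R -> A) (j i : nat) (t : R) :
  periodic f -> f (t + arc_shift j i) = f t.
Proof. intros Hf. unfold arc_shift. destruct (i <=? j)%nat; [now rewrite Rplus_0_r|apply Hf]. Qed.

(* On the cell of the [j]-th arc, the configurations other than [w] whose [j]-th arc maximum is at
   least [M] lie in the open half-space [k . (y - w) < 0]. *)
Definition supporting_functional (L K : R -> Rbar) (n : nat) (M : R) (w : nat -> R) (j : nat)
  (k : nat -> R) : Prop :=
  forall y t, in_arc_cell n j y t -> Rbar_le M (F L K n y t) ->
    (exists i, (i <= n)%nat /\ node y i <> node w i) ->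
    sum_f_R0 (fun i => k i * (node y i - node w i)) n < 0.

Section SupportingFunctional.

Variables (L K : R -> Rbar) (n j : nat) (w : nat -> R) (z M : R).
Hypotheses (SL : strictly_concave_kernel L) (SK : strictly_concave_kernel K).
Hypotheses (Hz : F L K n w z = M) (Hmax : forall t, Rbar_le (F L K n w t) M).
Hypothesis Hcell : in_arc_cell n j w z.
Hypothesis Hopen : forall i, (1 <= i <= n)%nat -> in_open (z - node w i + arc_shift j i).

Let HL : concave_kernel L := proj1 SL.
Let HK : concave_kernel K := proj1 SK.

(* Bringing the arguments back to [[0, 2 PI]] makes the summands of [F w] concave. *)
Let summand (i : nat) (t : R) : R := Kr (kernel_at L K i) (t + (arc_shift j i - node w i)).
Let summand_dom (i : nat) (t : R) : Prop :=
  kernel_dom (kernel_at L K i) (t + (arc_shift j i - node w i)).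

Lemma summand_strictly_concave (i : nat) : strictly_concave_on (summand_dom i) (summand i).
Proof.
  apply (strictly_concave_on_shift (kernel_dom (kernel_at L K i))).
  apply kernel_strictly_concave_on_dom. now destruct i.
Qed.

Lemma kernel_at_summand (i : nat) (t : R) :
  kernel_at L K i (t + (arc_shift j i - node w i)) = kernel_at L K i (t - node w i).
Proof.
  replace (t + (arc_shift j i - node w i)) with (t - node w i + arc_shift j i) by ring.
  apply periodic_arc_shift, kernel_periodic. now apply concave_kernel_at.
Qed.

Lemma summand_dom_iff (i : nat) (t : R) :
  summand_dom i t <-> 0 <= t - node w i + arc_shift j i <= 2 * PI /\
                      is_finite (kernel_at L K i (t - node w i)).
Proof.
  unfold summand_dom, kernel_dom. rewrite kernel_at_summand.
  now replace (t + (arc_shift j i - node w i)) with (t - node w i + arc_shift j i) by ring.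
Qed.

Lemma summand_eq (i : nat) (t : R) : summand i t = Kr (kernel_at L K i) (t - node w i).
Proof. unfold summand, Kr. now rewrite kernel_at_summand. Qed.

Lemma F_eq_sum_summand (t : R) :
  is_finite (F L K n w t) -> F L K n w t = Finite (sum_f_R0 (fun i => summand i t) n).
Proof.
  intros Ht. rewrite F_eq_sum by easy. f_equal. apply sum_eq. intros i _. now rewrite summand_eq.
Qed.

Lemma summand_dom_max_point (i : nat) : (i <= n)%nat -> summand_dom i z.
Proof.
  intros Hi. apply summand_dom_iff. split; [now apply Hcell|].
  apply (F_finite_iff L K HL HK n); [now rewrite Hz|easy].
Qed.

Lemma sum_summand_max_point : sum_f_R0 (fun i => summand i z) n = M.
Proof.
  assert (H := F_eq_sum_summand z). rewrite Hz in H. specialize (H eq_refl). now injection H.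
Qed.

Lemma summand_supergradients :
  exists k, (forall i, (i <= n)%nat -> supergradient (summand_dom i) (summand i) z (k i)) /\
            sum_f_R0 k n = 0.
Proof.
  apply supergradient_sum_inv.
  - intros i _. apply summand_strictly_concave.
  - apply summand_dom_max_point. lia.
  - intros i Hi. unfold summand_dom.
    apply (locally_comp_shift (kernel_dom (kernel_at L K i))).
    apply locally_kernel_dom; [now apply concave_kernel_at|].
    replace (z + (arc_shift j i - node w i)) with (z - node w i + arc_shift j i) by ring.
    now apply Hopen.
  - intros t Ht. rewrite Rmult_0_l, Rplus_0_r, sum_summand_max_point.
    assert (Hfin : is_finite (F L K n w t)).
    { apply F_finite_iff; [easy|easy|]. intros i Hi. now apply summand_dom_iff, Ht. }
    specialize (Hmax t). now rewrite F_eq_sum_summand in Hmax.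
Qed.

Lemma supporting_functional_exists : exists k, supporting_functional L K n M w j k.
Proof.
  destruct summand_supergradients as (k & Hk & Hk0). exists k. intros y t Hyt HM Hne.
  assert (Hfin : is_finite (F L K n y t)).
  { apply (Rbar_ge_finite M); [easy|now apply F_not_p_infty]. }
  (* Moving the nodes from [w] to [y] amounts to evaluating the [i]-th summand of [w] at [u i]. *)
  pose (u := fun i => t - (node y i - node w i)).
  assert (Hu : forall i, u i - node w i = t - node y i) by (intros i; unfold u; ring).
  assert (Hdom : forall i, (i <= n)%nat -> summand_dom i (u i)).
  { intros i Hi. apply summand_dom_iff. rewrite Hu. split; [now apply Hyt|].
    now apply (F_finite_iff L K HL HK n y t). }
  assert (Hmoved : exists i, (i <= n)%nat /\ u i <> z).
  { destruct Hne as (i & Hi & Hne). destruct (Req_dec t z) as [->|Htz].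
    - exists i. split; [easy|]. unfold u. lra.
    - exists 0%nat. split; [lia|]. unfold u. simpl. lra. }
  destruct Hmoved as (i0 & Hi0 & Hui0).
  rewrite (F_eq_sum L K HL HK) in HM by easy. simpl in HM.
  assert (Hlt : sum_f_R0 (fun i => Kr (kernel_at L K i) (t - node y i)) n <
    sum_f_R0 (fun i => summand i z + k i * (t - z) - k i * (node y i - node w i)) n).
  { assert (Hterm : forall i, (i <= n)%nat -> Kr (kernel_at L K i) (t - node y i) = summand i (u i))
      by (intros i _; now rewrite summand_eq, Hu).
    assert (Hbound : forall i, summand i z + k i * (t - z) - k i * (node y i - node w i)
                             = summand i z + k i * (u i - z)) by (intros i; unfold u; ring).
    apply sum_Rlt with i0; [intros i Hi|easy|]; rewrite Hterm, Hbound by easy.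
    - now apply Hk, Hdom.
    - apply (supergradient_strict (summand_dom i0));
        auto using summand_strictly_concave, summand_dom_max_point. }
  rewrite minus_sum, plus_sum, sum_summand_max_point, <- scal_sum, Hk0 in Hlt. lra.
Qed.

End SupportingFunctional.

(** * Equioscillation and uniqueness *)

Definition active (L K : R -> Rbar) (n : nat) (M : R) (w : nat -> R) (j : nat) : Prop :=
  exists z, on_arc n w j z /\ F L K n w z = M.

Section Minimax.

Variables (L K : R -> Rbar) (n : nat) (M : R) (w : nat -> R).
Hypotheses (SL : strictly_concave_kernel L) (SK : strictly_concave_kernel K).
Hypothesis Hcond : cond_infty' K \/ (C1_open K /\ C1_open L).
Hypotheses (Hmin : minimax L K n M w) (Hw : inT n w) (Hsorted : sorted_nodes n w).

Let HL : concave_kernel L := proj1 SL.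
Let HK : concave_kernel K := proj1 SK.

Lemma minimax_max_not_node (i : nat) (z : R) :
  (1 <= i <= n)%nat -> F L K n w z = M -> z <> w i /\ z <> w i + 2 * PI.
Proof.
  intros Hi Hz.
  assert (Hnode : F L K n w (w i) <> M).
  { intros E. assert (Hfin : is_finite (F L K n w (w i))) by now rewrite E.
    enough (exists t, Rbar_lt (F L K n w (w i)) (F L K n w t)) as [t Ht].
    { apply (Rbar_lt_not_le _ _ Ht). rewrite E. apply Hmin. }
    destruct Hcond as [Hinf|[CK CL]];
      [now apply node_not_max_cond_infty'|now apply node_not_max_C1]. }
  split; intros ->; apply Hnode; [easy|]. rewrite <- Hz. symmetry. now apply F_periodic.
Qed.

Lemma minimax_max_in_open_cell (j : nat) (z : R) :
  (j <= n)%nat -> on_arc n w j z -> F L K n w z = M ->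
  forall i, (1 <= i <= n)%nat -> in_open (z - node w i + arc_shift j i).
Proof.
  intros Hj Harc Hz i Hi. destruct (minimax_max_not_node i z Hi Hz) as [Hne Hne2PI].
  assert (Hcell := on_arc_in_cell n w j z Hsorted Hj Harc i ltac:(lia)).
  assert (Hcell0 := on_arc_in_cell n w j z Hsorted Hj Harc 0%nat ltac:(lia)).
  specialize (Hw i Hi). unfold in_open, arc_shift in *.
  destruct i as [|i]; [lia|]. simpl node in *. simpl in Hcell0.
  destruct (S i <=? j)%nat; lra.
Qed.

Lemma active_arc_nondegenerate (j : nat) :
  (j <= n)%nat -> active L K n M w j -> ext n w j < ext n w (S j).
Proof.
  intros Hj (z & [Hjz HzS] & Hz). apply Rnot_le_lt. intros Hle.
  assert (Hnode : forall i, (1 <= i <= n)%nat -> ext n w i <> z).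
  { intros i Hi E. destruct (minimax_max_not_node i z Hi Hz) as [Hne _].
    rewrite ext_node in E by lia. destruct i; [lia|]. now apply Hne. }
  destruct (Nat.eq_dec j 0) as [Hj0|Hj0]; [|apply (Hnode j); [lia|lra]].
  destruct (Nat.eq_dec n 0) as [Hn0|Hn0]; [|apply (Hnode (S j)); [lia|lra]].
  rewrite Hj0, Hn0 in Hle. unfold ext in Hle. simpl in Hle. pose proof two_PI_pos. lra.
Qed.

Lemma minimax_level_reached (y : nat -> R) : exists t, 0 <= t < 2 * PI /\ Rbar_le M (F L K n y t).
Proof.
  destruct (proj2 Hmin y) as [t Ht].
  destruct (F_representative L K HL HK n y t) as (t' & Ht' & E). exists t'. now rewrite E.
Qed.

Lemma minimax_level_eq (t : R) : Rbar_le M (F L K n w t) -> F L K n w t = M.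
Proof. intros Ht. apply Rbar_le_antisym; [apply Hmin|easy]. Qed.

(* Maximum points of [ys k] accumulate at a maximum point of [w], which lies strictly between the
   neighbouring nodes. *)
Lemma active_cell_nearby (ys : nat -> nat -> R) :
  (forall i, (1 <= i <= n)%nat -> is_lim_seq (fun k => ys k i) (w i)) ->
  exists j k t, (j <= n)%nat /\ active L K n M w j /\
    in_arc_cell n j (ys k) t /\ Rbar_le M (F L K n (ys k) t).
Proof.
  intros Hys.
  destruct (functional_choice _ (fun k => minimax_level_reached (ys k))) as [t Ht].
  destruct (bounded_subsequence t 0 (2 * PI)) as (phi & t0 & Hphi & Ht0 & Hlim).
  { intros k. destruct (Ht k). lra. }
  assert (Hlim_y : forall i, (1 <= i <= n)%nat -> is_lim_seq (fun k => ys (phi k) i) (w i)).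
  { intros i Hi. now apply (is_lim_seq_along (fun k => ys k i)), Hys. }
  assert (Hmax0 : F L K n w t0 = M).
  { apply minimax_level_eq.
    apply (F_ge_limit L K HL HK n (fun k => ys (phi k)) w (fun k => t (phi k))); auto.
    intros k. apply Ht. }
  destruct (on_arc_exists n w t0 Ht0) as (j & Hj & Harc).
  assert (Hcell : eventually (fun k => in_arc_cell n j (ys (phi k)) (t (phi k)))).
  { apply (filter_forall_upto (fun i k =>
      0 <= t (phi k) - node (ys (phi k)) i + arc_shift j i <= 2 * PI)).
    intros [|i] Hi.
    - exists 0%nat. intros k _. destruct (Ht (phi k)) as [Htk _]. unfold arc_shift. simpl. lra.
    - assert (Hopen := minimax_max_in_open_cell j t0 Hj Harc Hmax0 (S i) ltac:(lia)).
      assert (Hlim_i : is_lim_seq (fun k => t (phi k) - ys (phi k) (S i) + arc_shift j (S i))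
                                  (t0 - w (S i) + arc_shift j (S i))).
      { apply is_lim_seq_plus'; [|apply is_lim_seq_const].
        apply is_lim_seq_minus'; [easy|apply Hlim_y; lia]. }
      generalize (Hlim_i _ (locally_in_open _ Hopen)). unfold filtermap.
      apply filter_imp. unfold in_open. simpl. intros k Hk. lra. }
  destruct Hcell as [k Hk]. exists j, (phi k), (t (phi k)).
  split; [easy|]. split; [now exists t0|]. split; [now apply Hk|apply Ht].
Qed.

Lemma active_supporting_functionals :
  exists k : nat -> nat -> R, forall j, (j <= n)%nat -> active L K n M w j ->
    supporting_functional L K n M w j (k j).
Proof.
  apply (functional_choice (fun j k => (j <= n)%nat -> active L K n M w j ->
                                       supporting_functional L K n M w j k)).
  intros j. destruct (classic ((j <= n)%nat /\ active L K n M w j)) as [(Hj & z & Harc & Hz)|Hno].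
  - destruct (supporting_functional_exists L K n j w z M) as [k Hk]; auto.
    + apply Hmin.
    + now apply on_arc_in_cell.
    + now apply minimax_max_in_open_cell.
    + now exists k.
  - exists (fun _ => 0). intros Hj Hact. exfalso. auto.
Qed.

(* Otherwise all active arc maxima would be smaller than [M] along the ray from [w] in the
   direction [d]. *)
Lemma minimax_no_common_descent (k : nat -> nat -> R) (d : nat -> R) :
  (forall j, (j <= n)%nat -> active L K n M w j -> supporting_functional L K n M w j (k j)) ->
  d 0%nat = 0 -> (exists i, (i <= n)%nat /\ d i <> 0) ->
  exists j, (j <= n)%nat /\ active L K n M w j /\ sum_f_R0 (fun i => k j i * d i) n < 0.
Proof.
  intros Hk Hd0 (i0 & Hi0 & Hd).
  pose (ys := fun (p i : nat) => w i + RinvN p * d i).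
  destruct (active_cell_nearby ys) as (j & p & t & Hj & Hact & Hcell & Ht).
  { intros i _. replace (Finite (w i)) with (Finite (w i + 0 * d i)) by (f_equal; ring).
    apply is_lim_seq_plus'; [apply is_lim_seq_const|].
    apply is_lim_seq_mult'; [apply is_lim_seq_RinvN|apply is_lim_seq_const]. }
  exists j. split; [easy|]. split; [easy|].
  assert (Hp := cond_pos (RinvN p)).
  assert (Hnode : forall i, node (ys p) i - node w i = d i * RinvN p).
  { intros [|i]; unfold node, ys; [rewrite Hd0|]; ring. }
  assert (Hneg : sum_f_R0 (fun i => k j i * (node (ys p) i - node w i)) n < 0).
  { apply (Hk j Hj Hact _ t Hcell Ht). exists i0. split; [easy|]. intros E.
    specialize (Hnode i0). apply Hd, (Rmult_eq_reg_r (RinvN p)); lra. }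
  rewrite (sum_eq _ (fun i => k j i * d i * RinvN p)) in Hneg by (intros; rewrite Hnode; ring).
  rewrite <- scal_sum in Hneg. apply Rnot_le_lt. intros Hge.
  assert (0 <= RinvN p * sum_f_R0 (fun i => k j i * d i) n) by (apply Rmult_le_pos; lra). lra.
Qed.

(* Any [n] functionals are simultaneously nonnegative in some direction, so all [n + 1] arcs have to
   be active. *)
Lemma minimax_all_active (j : nat) : (j <= n)%nat -> active L K n M w j.
Proof.
  intros Hj. apply NNPP. intros Hinactive.
  destruct active_supporting_functionals as [k Hk].
  assert (Hn : (1 <= n)%nat).
  { destruct n as [|n'] eqn:En; [|lia]. exfalso. apply Hinactive. rewrite <- En in *.
    destruct (minimax_level_reached w) as (t & Ht & Hmax). exists t.
    destruct (on_arc_exists n w t) as (i & Hi & Harc); [lra|].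
    replace j with i by lia. split; [easy|now apply minimax_level_eq]. }
  destruct (common_nonneg_direction n (map k (seq 0 j ++ seq (S j) (n - j))))
    as (d & Hd0 & Hd & Hnonneg); [easy|rewrite length_map, length_app, !length_seq; lia|].
  destruct (minimax_no_common_descent k d Hk Hd0 Hd) as (i & Hi & Hact & Hneg).
  assert (Hij : i <> j) by congruence.
  enough (0 <= sum_f_R0 (fun l => k i l * d l) n) by lra.
  apply Hnonneg, in_map, in_or_app. rewrite !in_seq. lia.
Qed.

Lemma minimax_nodes_increasing (j : nat) : (j <= n)%nat -> ext n w j < ext n w (S j).
Proof. intros Hj. apply active_arc_nondegenerate; [easy|now apply minimax_all_active]. Qed.

(* If [x <> w], all the functionals would be positive in the direction [w - x]. *)
Lemma minimax_arc_maxima_unique (x : nat -> R) :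
  sorted_nodes n x ->
  (forall j, (j <= n)%nat -> exists z, on_arc n x j z /\ Rbar_le M (F L K n x z)) ->
  forall i, (1 <= i <= n)%nat -> x i = w i.
Proof.
  intros Hx Hmax. destruct active_supporting_functionals as [k Hk].
  assert (Hsame : forall i, (i <= n)%nat -> node x i = node w i).
  { intros i Hi. apply NNPP. intros Hne.
    destruct (minimax_no_common_descent k (fun i => node w i - node x i) Hk)
      as (j & Hj & Hact & Hneg); [simpl; ring|exists i; split; [easy|lra]|].
    destruct (Hmax j Hj) as (z & Harc & Hz).
    assert (Hpos := Hk j Hj Hact x z (on_arc_in_cell n x j z Hx Hj Harc) Hz
      (ex_intro _ i (conj Hi Hne))).
    assert (Hopp : sum_f_R0 (fun i => k j i * (node w i - node x i)) n
                 = -1 * sum_f_R0 (fun i => k j i * (node x i - node w i)) n).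
    { rewrite scal_sum. apply sum_eq. intros; ring. }
    lra. }
  intros i Hi. specialize (Hsame i ltac:(lia)). destruct i; [lia|easy].
Qed.

End Minimax.

Definition rotate (n : nat) (w : nat -> R) (k : nat) : R := ext n w (S k) - w 1%nat.

Lemma F_rotate (K : R -> Rbar) (n : nat) (w : nat -> R) (t : R) :
  concave_kernel K -> (1 <= n)%nat -> F K K n (rotate n w) t = F K K n w (t + w 1%nat).
Proof.
  intros HK Hn. pose (u := t + w 1%nat).
  assert (Hplus : forall x p, x <> p_infty -> exp_Rbar (Rbar_plus x (sumK K w u p)) =
    exp_Rbar x * exp_Rbar (sumK K w u p)).
  { intros x p Hx. apply exp_Rbar_plus; [easy|now apply sumK_not_p_infty]. }
  assert (Hprod : forall p, (p <= n)%nat -> exp_Rbar (F K K p (rotate n w) t) =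
    exp_Rbar (K (u - ext n w (S p))) * exp_Rbar (sumK K w u p)).
  { induction p as [|p IH]; intros Hp.
    - rewrite F_0, ext_node by lia. simpl. unfold u.
      replace (t + w 1%nat - w 1%nat) with t by ring. rewrite exp_0. ring.
    - rewrite exp_F_succ, IH by (easy || lia). simpl sumK.
      rewrite Rbar_plus_comm, Hplus by now apply kernel_not_p_infty.
      rewrite (ext_node n w (S p)) by easy. unfold rotate, u. simpl node.
      replace (t - (ext n w (S (S p)) - w 1%nat)) with (t + w 1%nat - ext n w (S (S p))) by ring.
      ring. }
  assert (Hexp : exp_Rbar (F K K n (rotate n w) t) = exp_Rbar (F K K n w u)).
  { unfold F at 2. rewrite Hprod, ext_last, Hplus by (easy || now apply kernel_not_p_infty).
    rewrite <- (kernel_periodic K HK (u - 2 * PI)).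
    now replace (u - 2 * PI + 2 * PI) with u by ring. }
  apply Rbar_le_antisym; apply F_le_iff_exp; auto; fold u; rewrite Hexp; lra.
Qed.

Lemma inT_rotate (n : nat) (w : nat -> R) :
  sorted_nodes n w -> 0 < w 1%nat -> inT n (rotate n w).
Proof.
  intros Hs Hw1 k Hk. unfold rotate.
  assert (Ew1 : ext n w 1 = w 1%nat) by now rewrite ext_node by lia.
  pose proof (sorted_nodes_range n w (S k) Hs ltac:(lia)).
  pose proof (sorted_nodes_le n w 1 (S k) Hs ltac:(lia)). lra.
Qed.

Lemma sorted_nodes_rotate (n : nat) (w : nat -> R) :
  sorted_nodes n w -> 0 < w 1%nat -> sorted_nodes n (rotate n w).
Proof.
  intros Hs Hw1 k Hk. assert (Hx := inT_rotate n w Hs Hw1). pose proof two_PI_pos as HP.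
  destruct (Nat.eq_dec k n) as [->|Hkn].
  - rewrite ext_last, ext_node by easy. destruct n as [|n']; [simpl; lra|].
    apply Rlt_le, Hx. lia.
  - rewrite !ext_node by lia. destruct k as [|k]; [apply Hx; lia|].
    simpl. unfold rotate. specialize (Hs (S (S k)) ltac:(lia)). lra.
Qed.

Lemma rotate_invariant_equidistant (n : nat) (w : nat -> R) (j : nat) :
  (forall i, (1 <= i <= n)%nat -> rotate n w i = w i) ->
  (1 <= j <= n)%nat -> w j = 2 * PI * INR j / INR (S n).
Proof.
  intros Heq Hj.
  assert (Hlin : forall i, (i <= S n)%nat -> ext n w i = INR i * w 1%nat).
  { induction i as [|[|i] IH]; intros Hi.
    - unfold ext. simpl. ring.
    - rewrite ext_node by lia. simpl. ring.
    - rewrite S_INR, Rmult_plus_distr_r, <- IH by lia. rewrite (ext_node n w (S i)) by lia.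
      simpl node. rewrite <- (Heq (S i)) by lia. unfold rotate. ring. }
  assert (Hlast := Hlin (S n) (le_n _)). rewrite ext_last in Hlast.
  assert (Ej : w j = INR j * w 1%nat).
  { rewrite <- Hlin, ext_node by lia. destruct j; [lia|easy]. }
  assert (0 < INR (S n)) by (apply lt_0_INR; lia).
  rewrite Ej, Hlast. field. lra.
Qed.

(* Rotating the circle so that the first node moves to [0] gives another minimax configuration. *)
Lemma minimax_equidistant (K : R -> Rbar) (n : nat) (M : R) (w : nat -> R) (j : nat) :
  strictly_concave_kernel K -> cond_infty' K \/ (C1_open K /\ C1_open K) ->
  minimax K K n M w -> inT n w -> sorted_nodes n w ->
  (1 <= j <= n)%nat -> w j = 2 * PI * INR j / INR (S n).
Proof.
  intros SK Hcond Hmin Hw Hs Hj. pose proof SK as [HK _].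
  assert (Hw1 : 0 < w 1%nat).
  { assert (H := minimax_nodes_increasing K K n M w SK SK Hcond Hmin Hw Hs 0 ltac:(lia)).
    now rewrite !ext_node in H by lia. }
  assert (Hrot : minimax K K n M (rotate n w)).
  { split; [|apply Hmin]. intros t. rewrite F_rotate by (easy || lia). apply Hmin. }
  apply rotate_invariant_equidistant; [|easy].
  apply (minimax_arc_maxima_unique K K n M w SK SK Hcond Hmin Hw Hs);
    [now apply sorted_nodes_rotate|].
  intros i Hi.
  destruct (minimax_all_active K K n M (rotate n w) SK SK Hcond Hrot) with (j := i)
    as (z & Hz & E); [now apply inT_rotate|now apply sorted_nodes_rotate|easy|].
  exists z. rewrite E. split; [easy|apply Rbar_le_refl].
Qed.

(** * Sorting permutations *)

Module NodeOrder <: Orders.TotalLeBool.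
  Definition t := (R * nat)%type.
  Definition leb (p q : t) : bool := if Rle_dec (fst p) (fst q) then true else false.
  Lemma leb_total (p q : t) : leb p q = true \/ leb q p = true.
  Proof.
    unfold leb. destruct (Rle_dec (fst p) (fst q)), (Rle_dec (fst q) (fst p)); auto. lra.
  Qed.
End NodeOrder.

Module NodeSort := Mergesort.Sort NodeOrder.

Lemma Sorted_nth {A : Type} (Rel : A -> A -> Prop) (l : list A) (d : A) (k : nat) :
  Sorted Rel l -> (S k < length l)%nat -> Rel (nth k l d) (nth (S k) l d).
Proof.
  intros Hs. revert k. induction Hs as [|a l Hs IH Ha]; intros k Hk; [simpl in Hk; lia|].
  destruct k as [|k].
  - destruct l as [|b l]; [simpl in Hk; lia|]. now apply HdRel_inv in Ha.
  - change (Rel (nth k l d) (nth (S k) l d)). apply IH. simpl in Hk. lia.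
Qed.

Lemma ext_sext (n : nat) (y : nat -> R) (s : nat -> nat) (k : nat) :
  perm_on n s -> (k <= S n)%nat -> ext n y (sext n s k) = ext n (fun i => y (s i)) k.
Proof.
  intros [Hrange _] Hk. unfold sext.
  destruct (Nat.eqb_spec k 0) as [->|Hk0]; [easy|].
  destruct (Nat.eqb_spec k (S n)) as [->|HkS]; [now rewrite !ext_last|].
  specialize (Hrange k ltac:(lia)). rewrite !ext_node by lia.
  destruct k; [lia|]. simpl. now destruct (s (S k)); [lia|].
Qed.

Lemma is_sorting_iff (n : nat) (y : nat -> R) (s : nat -> nat) :
  is_sorting n y s <-> perm_on n s /\ sorted_nodes n (fun i => y (s i)).
Proof.
  split; intros [Hp H]; (split; [easy|]); intros k Hk; specialize (H k Hk).
  - now rewrite !ext_sext in H by (auto; lia).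
  - now rewrite !ext_sext by (auto; lia).
Qed.

Lemma sorting_exists (n : nat) (y : nat -> R) : inT n y -> exists s, is_sorting n y s.
Proof.
  intros Hy. pose (l := map (fun i => (y i, i)) (seq 1 n)).
  assert (Hperm := NodeSort.Permuted_sort l). assert (Hsorted := NodeSort.Sorted_sort l).
  set (l' := NodeSort.sort l) in *. pose (s := fun k => snd (nth (k - 1) l' (0, 0%nat))).
  assert (Hlen : length l' = n)
    by (rewrite <- (Permutation_length Hperm); unfold l; now rewrite length_map, length_seq).
  assert (Hnth : forall k, (1 <= k <= n)%nat ->
    nth (k - 1) l' (0, 0%nat) = (y (s k), s k) /\ (1 <= s k <= n)%nat).
  { intros k Hk. unfold s.
    assert (Hin : In (nth (k - 1) l' (0, 0%nat)) l)
      by (apply (Permutation_in _ (Permutation_sym Hperm)), nth_In; lia).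
    apply in_map_iff in Hin as (i & <- & Hi). apply in_seq in Hi. simpl. split; [easy|lia]. }
  exists s. apply is_sorting_iff. split; [split|].
  - intros k Hk. now apply Hnth.
  - intros i j Hi Hj E. enough (i - 1 = j - 1)%nat by lia.
    apply (proj1 (NoDup_nth l' (0, 0%nat))); [|lia|lia|].
    + apply (Permutation_NoDup Hperm), Injective_map_NoDup; [|apply seq_NoDup].
      intros p q Epq. now injection Epq.
    + rewrite (proj1 (Hnth i Hi)), (proj1 (Hnth j Hj)). now rewrite E.
  - intros k Hk. pose proof two_PI_pos as HP.
    assert (Hys : forall i, (1 <= i <= n)%nat -> 0 <= y (s i) < 2 * PI)
      by (intros i Hi; apply Hy, Hnth, Hi).
    destruct (Nat.eq_dec k n) as [->|Hkn].
    + rewrite ext_last, ext_node by easy. destruct n; [simpl; lra|]. apply Rlt_le, Hys. lia.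
    + rewrite !ext_node by lia. destruct k as [|k]; [apply Hys; lia|].
      assert (Hle := Sorted_nth _ l' (0, 0%nat) k Hsorted ltac:(lia)).
      assert (Ek := proj1 (Hnth (S k) ltac:(lia))).
      assert (ESk := proj1 (Hnth (S (S k)) ltac:(lia))).
      simpl in Ek, ESk. rewrite Nat.sub_0_r in Ek. rewrite Ek, ESk in Hle.
      unfold is_true, NodeOrder.leb in Hle. simpl in *.
      now destruct (Rle_dec (y (s (S k))) (y (s (S (S k))))).
Qed.

Lemma sort_perm_sorting (n : nat) (y : nat -> R) : inT n y -> is_sorting n y (sort_perm n y).
Proof. intros Hy. unfold sort_perm. apply epsilon_spec. now apply sorting_exists. Qed.

Lemma perm_on_inverse (n : nat) (s : nat -> nat) :
  perm_on n s -> exists s', perm_on n s' /\ forall j, (1 <= j <= n)%nat -> s (s' j) = j.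
Proof.
  intros Hs.
  destruct (functional_choice (fun j i =>
    (1 <= j <= n)%nat -> (1 <= i <= n)%nat /\ s i = j)) as [s' Hs'].
  { intros j. destruct (classic (1 <= j <= n)%nat) as [Hj|]; [|now exists 0%nat].
    assert (Hin : In j (map s (seq 1 n)))
      by (apply (Permutation_in j (Permutation_sym (perm_on_Permutation n s Hs))), in_seq; lia).
    apply in_map_iff in Hin as (i & E & Hi). apply in_seq in Hi. exists i. split; [lia|easy]. }
  exists s'. split; [split|].
  - intros j Hj. now apply Hs'.
  - intros i j Hi Hj E. rewrite <- (proj2 (Hs' i Hi)), <- (proj2 (Hs' j Hj)). now rewrite E.
  - intros j Hj. now apply Hs'.
Qed.

(** * Suprema, infima and the minimax property *)

Lemma supB_attained {A : Type} (P : A -> Prop) (f : A -> Rbar) (z : A) :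
  P z -> (forall x, P x -> Rbar_le (f x) (f z)) -> supB P f = f z.
Proof.
  intros Hz H. apply Rbar_is_lub_unique. split.
  - intros v (x & Hx & ->). now apply H.
  - intros b Hb. apply Hb. now exists z.
Qed.

Lemma infB_attained {A : Type} (P : A -> Prop) (f : A -> Rbar) (z : A) :
  P z -> (forall x, P x -> Rbar_le (f z) (f x)) -> infB P f = f z.
Proof.
  intros Hz H. apply Rbar_is_glb_unique. split.
  - intros v (x & Hx & ->). now apply H.
  - intros b Hb. apply Hb. now exists z.
Qed.

Lemma infB_le {A : Type} (P : A -> Prop) (f : A -> Rbar) (z : A) :
  P z -> Rbar_le (infB P f) (f z).
Proof.
  intros Hz. unfold infB.
  destruct (Rbar_ex_glb (fun v => exists x, P x /\ v = f x)) as [g Hg].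
  rewrite (Rbar_is_glb_unique _ _ Hg). apply Hg. now exists z.
Qed.

Section Extrema.

Variables (L K : R -> Rbar) (n : nat).
Hypotheses (HL : concave_kernel L) (HK : concave_kernel K).

Lemma supF_attained (y : nat -> R) :
  exists z, 0 <= z < 2 * PI /\ supF L K n y = F L K n y z /\
    forall t, Rbar_le (F L K n y t) (F L K n y z).
Proof.
  destruct (F_max L K HL HK n y) as (z & Hz & Hmax). exists z. split; [easy|]. split; [|easy].
  now apply supB_attained.
Qed.

Lemma msig_attained (y : nat -> R) (s : nat -> nat) (k : nat) :
  is_sorting n y s -> (k <= n)%nat ->
  exists z, on_arc n (fun i => y (s i)) k z /\ msig L K n y s k = F L K n y z /\
    forall t, on_arc n (fun i => y (s i)) k t -> Rbar_le (F L K n y t) (F L K n y z).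
Proof.
  intros Hs Hk. apply is_sorting_iff in Hs as [Hp Hs].
  destruct (F_max_interval L K HL HK n y _ _ (Hs k Hk)) as (z & Hz & Hmax).
  exists z. split; [easy|]. split; [|easy].
  unfold msig. rewrite !ext_sext by (auto; lia). now apply supB_attained.
Qed.

Lemma mbar_intervals_supF (y : nat -> R) : inT n y -> mbar_intervals L K n y = supF L K n y.
Proof.
  intros Hy. assert (Hs := sort_perm_sorting n y Hy). unfold mbar_intervals.
  set (s := sort_perm n y) in *. destruct (supF_attained y) as (z & Hz & -> & Hmax).
  destruct (on_arc_exists n (fun i => y (s i)) z) as (k & Hk & Harc); [lra|].
  destruct (msig_attained y s k Hs Hk) as (zk & _ & Ek & Hmaxk).
  assert (E : msig L K n y s k = F L K n y z).
  { rewrite Ek. apply Rbar_le_antisym; [apply Hmax|now apply Hmaxk]. }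
  rewrite <- E. apply (supB_attained (fun k => (k <= n)%nat) (msig L K n y s) k Hk).
  intros i Hi. destruct (msig_attained y s i Hs Hi) as (zi & _ & -> & _). rewrite E. apply Hmax.
Qed.

Lemma minimax_permute (M : R) (w : nat -> R) (s : nat -> nat) :
  perm_on n s -> minimax L K n M w -> minimax L K n M (fun i => w (s i)).
Proof.
  intros Hs [Hmax Hge]. split; [|easy]. intros t. rewrite F_permute by easy. apply Hmax.
Qed.

Lemma inT_permute (w : nat -> R) (s : nat -> nat) :
  perm_on n s -> inT n w -> inT n (fun i => w (s i)).
Proof. intros [Hs _] Hw i Hi. apply Hw, Hs, Hi. Qed.

Lemma sorted_minimax_exists :
  exists M w, inT n w /\ sorted_nodes n w /\ minimax L K n M w.
Proof.
  destruct (minimax_exists L K n HL HK) as (M & w & Hw & Hmin).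
  destruct (sorting_exists n w Hw) as [s Hs]. apply is_sorting_iff in Hs as [Hp Hs].
  exists M, (fun i => w (s i)).
  split; [now apply inT_permute|]. split; [easy|now apply minimax_permute].
Qed.

Lemma minimax_le_supF (M : R) (w y : nat -> R) :
  minimax L K n M w -> Rbar_le M (supF L K n y).
Proof.
  intros [_ Hge]. destruct (supF_attained y) as (z & _ & -> & Hmax).
  destruct (Hge y) as [t Ht]. now apply Rbar_le_trans with (1 := Ht).
Qed.

Lemma minimax_supF (M : R) (w : nat -> R) : minimax L K n M w -> supF L K n w = M.
Proof.
  intros Hmin. apply Rbar_le_antisym; [|now apply minimax_le_supF with w].
  destruct (supF_attained w) as (z & _ & -> & _). apply Hmin.
Qed.

Lemma supF_eq_minimax (M : R) (w w' : nat -> R) :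
  minimax L K n M w -> supF L K n w' = M -> minimax L K n M w'.
Proof.
  intros [_ Hge] E. split; [|easy]. intros t. rewrite <- E.
  destruct (supF_attained w') as (z & _ & -> & Hmax). apply Hmax.
Qed.

Lemma minimax_bigM (M : R) (w : nat -> R) : inT n w -> minimax L K n M w -> bigM L K n = M.
Proof.
  intros Hw Hmin. rewrite <- (minimax_supF M w Hmin). apply infB_attained; [easy|].
  intros y _. rewrite (minimax_supF M w Hmin). now apply minimax_le_supF with w.
Qed.

Lemma infB_mbar_intervals : infB (inT n) (mbar_intervals L K n) = bigM L K n.
Proof.
  apply Rbar_glb_rw. intros v. split; intros (y & Hy & ->); exists y;
    now rewrite mbar_intervals_supF.
Qed.

End Extrema.

Section MinimaxTheorem.

Variables (L K : R -> Rbar) (n : nat) (M : R) (w : nat -> R).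
Hypotheses (SL : strictly_concave_kernel L) (SK : strictly_concave_kernel K).
Hypothesis Hcond : cond_infty' K \/ (C1_open K /\ C1_open L).
Hypotheses (Hmin : minimax L K n M w) (Hw : inT n w) (Hsorted : sorted_nodes n w).

Let HL : concave_kernel L := proj1 SL.
Let HK : concave_kernel K := proj1 SK.

Lemma minimax_nodes_distinct (i j : nat) :
  (i <= n)%nat -> (j <= n)%nat -> i <> j -> ext n w i <> ext n w j.
Proof.
  assert (Hlt : forall p q, (p < q <= n)%nat -> ext n w p < ext n w q).
  { intros p q Hpq. apply Rlt_le_trans with (ext n w (S p)).
    - apply (minimax_nodes_increasing L K n M w); auto. lia.
    - apply sorted_nodes_le; [easy|lia]. }
  intros Hi Hj Hne. destruct (Nat.lt_total i j) as [H|[H|H]]; [|easy|].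
  - apply Rlt_not_eq, Hlt. lia.
  - apply Rgt_not_eq, Hlt. lia.
Qed.

Lemma minimax_msig (s : nat -> nat) (k : nat) :
  is_sorting n w s -> (k <= n)%nat -> msig L K n w s k = M.
Proof.
  intros Hs Hk. destruct (msig_attained L K n HL HK w s k Hs Hk) as (z & _ & -> & Hmax).
  apply is_sorting_iff in Hs as [Hp Hs].
  destruct (minimax_all_active L K n M (fun i => w (s i)) SL SK Hcond) with (j := k)
    as (z' & Harc & E); auto using minimax_permute, inT_permute.
  rewrite F_permute in E by easy.
  apply Rbar_le_antisym; [apply Hmin|]. rewrite <- E. now apply Hmax.
Qed.

Lemma minimax_munder : munder L K n w = M.
Proof.
  assert (Hs := sort_perm_sorting n w Hw). unfold munder, mink.
  rewrite (infB_attained _ _ 0%nat); [now apply minimax_msig; [|lia]|lia|].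
  intros k Hk. rewrite !minimax_msig by (easy || lia). apply Rbar_le_refl.
Qed.

(* If all arc maxima of [y] exceeded [M], then [y] would be [w] up to order, a contradiction. *)
Lemma munder_le_minimax (y : nat -> R) : inT n y -> Rbar_le (munder L K n y) M.
Proof.
  intros Hy. apply Rbar_not_lt_le. intros Hlt.
  assert (Hs := sort_perm_sorting n y Hy). unfold munder in Hlt. set (s := sort_perm n y) in *.
  pose proof (proj1 (is_sorting_iff n y s) Hs) as [Hp Hsorted_y].
  assert (Hmax : forall k, (k <= n)%nat -> exists z,
    on_arc n (fun i => y (s i)) k z /\ Rbar_lt M (F L K n y z)).
  { intros k Hk. destruct (msig_attained L K n HL HK y s k Hs Hk) as (z & Harc & E & _).
    exists z. split; [easy|]. rewrite <- E. apply Rbar_lt_le_trans with (1 := Hlt).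
    now apply (infB_le (fun k => (k <= n)%nat) (msig L K n y s)). }
  assert (Heq : forall i, (1 <= i <= n)%nat -> y (s i) = w i).
  { apply (minimax_arc_maxima_unique L K n M w SL SK Hcond Hmin Hw Hsorted _ Hsorted_y).
    intros k Hk. destruct (Hmax k Hk) as (z & Harc & Hz). exists z. split; [easy|].
    rewrite F_permute by easy. now apply Rbar_lt_le. }
  destruct (Hmax 0%nat ltac:(lia)) as (z & _ & Hz). apply (Rbar_lt_not_le _ _ Hz).
  rewrite <- (F_permute L K HL HK n y s) by easy.
  rewrite (F_ext L K HL HK n _ w) by easy. apply Hmin.
Qed.

Lemma minimax_smallm : smallm L K n = M.
Proof.
  rewrite <- minimax_munder. apply supB_attained; [easy|].
  intros y Hy. rewrite minimax_munder. now apply munder_le_minimax.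
Qed.

Lemma minimax_unique (w' : nat -> R) :
  inT n w' -> minimax L K n M w' ->
  exists s, perm_on n s /\ forall j, (1 <= j <= n)%nat -> w' j = w (s j).
Proof.
  intros Hw' Hmin'. destruct (sorting_exists n w' Hw') as [s Hs].
  apply is_sorting_iff in Hs as [Hp Hs].
  assert (Heq : forall i, (1 <= i <= n)%nat -> w' (s i) = w i).
  { apply (minimax_arc_maxima_unique L K n M w SL SK Hcond Hmin Hw Hsorted _ Hs).
    intros k Hk. destruct (minimax_all_active L K n M (fun i => w' (s i)) SL SK Hcond) with (j := k)
      as (z & Harc & E); auto using minimax_permute, inT_permute.
    exists z. rewrite E. split; [easy|apply Rbar_le_refl]. }
  destruct (perm_on_inverse n s Hp) as (s' & Hp' & Hinv). exists s'. split; [easy|].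
  intros j Hj. rewrite <- Heq by now apply Hp'. now rewrite Hinv.
Qed.

End MinimaxTheorem.

Theorem theorem11p6 (L K : R -> Rbar) (n : nat) :
  strictly_concave_kernel L -> strictly_concave_kernel K ->
  (cond_infty' K \/ (C1_open K /\ C1_open L)) ->
  exists w : nat -> R,
    inT n w /\
    supF L K n w = bigM L K n /\
    (* uniqueness up to permutation of coordinates *)
    (forall w', inT n w' -> supF L K n w' = bigM L K n ->
       exists s, perm_on n s /\ forall j, (1 <= j <= n)%nat -> w' j = w (s j)) /\
    (* (a) *)
    (forall i j, (i <= n)%nat -> (j <= n)%nat -> i <> j -> ext n w i <> ext n w j) /\
    (forall s, is_sorting n w s ->
       forall k, (k <= n)%nat -> msig L K n w s k = msig L K n w s 0) /\
    (* (b) *)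
    bigM L K n = infB (inT n) (mbar_intervals L K n) /\
    infB (inT n) (mbar_intervals L K n) = supB (inT n) (munder L K n) /\
    supB (inT n) (munder L K n) = smallm L K n /\
    (* (c) *)
    (forall x y, inT n x -> inT n y ->
       Rbar_le (munder L K n x) (smallm L K n) /\
       smallm L K n = bigM L K n /\
       Rbar_le (bigM L K n) (supF L K n y)) /\
    (* (d) *)
    (L = K -> exists s, perm_on n s /\
       forall j, (1 <= j <= n)%nat -> w (s j) = 2 * PI * INR j / INR (S n)).
Proof.
  intros SL SK Hcond. pose proof SL as [HL _]. pose proof SK as [HK _].
  destruct (sorted_minimax_exists L K n HL HK) as (M & w & Hw & Hsorted & Hmin).
  assert (HbigM : bigM L K n = M) by now apply minimax_bigM with w.
  assert (Hsmallm : smallm L K n = M) by now apply minimax_smallm with w.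
  exists w. rewrite infB_mbar_intervals, HbigM by easy. fold (smallm L K n). rewrite Hsmallm.
  split; [easy|]. split; [now apply minimax_supF|]. split; [|split; [|split]].
  - intros w' Hw' E. apply (minimax_unique L K n M w); auto. now apply supF_eq_minimax with w.
  - now apply (minimax_nodes_distinct L K n M).
  - intros s Hs k Hk. rewrite !(minimax_msig L K n M) by (easy || lia). reflexivity.
  - do 3 (split; [reflexivity|]). split.
    + intros x y Hx Hy. split; [now apply munder_le_minimax with w|].
      split; [reflexivity|now apply minimax_le_supF with w].
    + intros ->. exists (fun j => j). split; [now split|].
      intros j Hj. now apply (minimax_equidistant K n M).
Qed.
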